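(* There is an algorithm which, given as input two regular languages $L_1,L_2\subseteq A^*$ over a finite alphabet $A$, decides whether $L_1$ is $\Sigma_2(<)$-separable from $L_2$. Likewise, there is an algorithm which, given the same input, decides whether $L_1$ is $\Pi_2(<)$-separable from $L_2$.
   Context: Words over $A$ (including the empty word) are viewed as logical structures: the positions are linearly ordered by $<$ and each carries a letter of $A$. First-order logic $\mathrm{FO}(<)$ uses a unary predicate $P_a$ for each $a\in A$ and the binary predicate $<$. A formula is $\Sigma_i(<)$ (resp. $\Pi_i(<)$) if its prenex normal form has either exactly $i$ quantifier blocks, the first one existential (resp. universal), or strictly fewer than $i$ quantifier blocks. The same names denote the classes of languages $\{w\in A^*\mid w\models\varphi\}$ defined by sentences $\varphi$ of the given type. For a class $\mathcal C$ of languages, $L_1$ is $\mathcal C$-separable from $L_2$ if there is $K\in\mathcal C$ with $L_1\subseteq K$ and $K\cap L_2=\emptyset$. Regular languages are given as input by any standard finite representation (e.g. finite automata, or morphisms into finite monoids with accepting sets). *)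

(* Defs.v *)
From mathcomp Require Import all_boot.
Set Implicit Arguments.
Unset Strict Implicit.
Unset Printing Implicit Defensive.

(** * Languages and separation *)

Definition language (A : finType) := seq A -> Prop.

Definition separable (A : finType) (C : language A -> Prop)
    (L1 L2 : language A) : Prop :=
  exists K : language A,
    [/\ C K, forall w, L1 w -> K w & forall w, ~ (K w /\ L2 w)].

(** * First-order logic over words *)

Inductive quantifier := Ex | All.
Inductive connective := And | Or.

Definition dual (q : quantifier) := if q is Ex then All else Ex.
Definition is_ex (q : quantifier) := if q is Ex then true else false.

(** Variables are de Bruijn indices: [Quant q f] binds the index [0] of [f]. *)
Inductive formula (A : finType) : Type :=
  | Letter of A & nat
  | Less of nat & nat
  | Equal of nat & nat
  | Not of formula A
  | Conn of connective & formula A & formula A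
  | Quant of quantifier & formula A.

Arguments Less {A}.
Arguments Equal {A}.

Definition scons (T : Type) (x : T) (e : nat -> T) (n : nat) : T :=
  if n is m.+1 then e m else x.

(** Positions of [w] are the numbers below [size w]; on the empty word the
    quantifiers range over the empty set.  The environment [e] only matters for
    the free variables. *)
Fixpoint sat (A : finType) (w : seq A) (e : nat -> nat) (f : formula A) : bool :=
  match f with
  | Letter a x => onth w (e x) == Some a
  | Less x y => e x < e y
  | Equal x y => e x == e y
  | Not g => ~~ sat w e g
  | Conn And g h => sat w e g && sat w e h
  | Conn Or g h => sat w e g || sat w e h
  | Quant Ex g => [exists i : 'I_(size w), sat w (scons (val i) e) g]
  | Quant All g => [forall i : 'I_(size w), sat w (scons (val i) e) g]
  end.

(** The free variables of [f] are among the indices below [n]. *)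
Fixpoint closed (A : finType) (n : nat) (f : formula A) : bool :=
  match f with
  | Letter _ x => x < n
  | Less x y | Equal x y => (x < n) && (y < n)
  | Not g => closed n g
  | Conn _ g h => closed n g && closed n h
  | Quant _ g => closed n.+1 g
  end.

Definition sentence (A : finType) (f : formula A) : bool := closed 0 f.

Definition models (A : finType) (w : seq A) (f : formula A) : bool :=
  sat w (fun _ => 0) f.

(** * Prenex normal forms and quantifier alternation *)

Fixpoint rename (A : finType) (r : nat -> nat) (f : formula A) : formula A :=
  match f with
  | Letter a x => Letter a (r x)
  | Less x y => Less (r x) (r y)
  | Equal x y => Equal (r x) (r y)
  | Not g => Not (rename r g)
  | Conn c g h => Conn c (rename r g) (rename r h)
  | Quant q g => Quant q (rename (scons 0 (succn \o r)) g)
  end.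

Definition shift (A : finType) (f : formula A) : formula A := rename succn f.

(** The textbook rules moving quantifiers outwards, applied anywhere inside a
    formula. *)
Inductive prenex_step (A : finType) : formula A -> formula A -> Prop :=
  | pull_not q f :
      prenex_step (Not (Quant q f)) (Quant (dual q) (Not f))
  | pull_left c q f g :
      prenex_step (Conn c (Quant q f) g) (Quant q (Conn c f (shift g)))
  | pull_right c q f g :
      prenex_step (Conn c f (Quant q g)) (Quant q (Conn c (shift f) g))
  | step_not f f' :
      prenex_step f f' -> prenex_step (Not f) (Not f')
  | step_left c f f' g :
      prenex_step f f' -> prenex_step (Conn c f g) (Conn c f' g)
  | step_right c f g g' :
      prenex_step g g' -> prenex_step (Conn c f g) (Conn c f g')
  | step_quant q f f' :
      prenex_step f f' -> prenex_step (Quant q f) (Quant q f').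

Inductive prenex_steps (A : finType) : formula A -> formula A -> Prop :=
  | prenex_refl f : prenex_steps f f
  | prenex_trans f g h :
      prenex_step f g -> prenex_steps g h -> prenex_steps f h.

Fixpoint quantifier_free (A : finType) (f : formula A) : bool :=
  match f with
  | Letter _ _ | Less _ _ | Equal _ _ => true
  | Not g => quantifier_free g
  | Conn _ g h => quantifier_free g && quantifier_free h
  | Quant _ _ => false
  end.

Fixpoint prenex (A : finType) (f : formula A) : bool :=
  if f is Quant _ g then prenex g else quantifier_free f.

(** The leading quantifiers of a formula; [true] stands for [Ex]. *)
Fixpoint prefix_of (A : finType) (f : formula A) : bitseq :=
  if f is Quant q g then is_ex q :: prefix_of g else [::].

(** Number of maximal blocks of identical quantifiers. *)
Fixpoint nblocks (s : bitseq) : nat :=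
  if s is b :: s' then (head (~~ b) s' != b) + nblocks s' else 0.

(** [b = true] for Sigma_i and [b = false] for Pi_i.  The formula [f] itself
    need not be prenex.  Prenex normal forms are not unique, so [f] is in the
    class as soon as one of them has the required prefix.  The normal form only
    serves to classify [f]: [f] and [g] are equivalent on nonempty words but may
    differ on the empty word, where the meaning is that of [f]. *)
Definition alternation (A : finType) (b : bool) (i : nat) (f : formula A) :
    Prop :=
  exists g : formula A,
    [/\ prenex_steps f g, prenex g &
        (nblocks (prefix_of g) = i /\ head b (prefix_of g) = b) \/
        nblocks (prefix_of g) < i].

Definition definable (A : finType) (P : formula A -> Prop) (K : language A) :
    Prop :=
  exists f : formula A,
    [/\ sentence f, P f & forall w, K w <-> models w f].

Definition Sigma (A : finType) (i : nat) : language A -> Prop :=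
  definable (alternation true i).

Definition Pi (A : finType) (i : nat) : language A -> Prop :=
  definable (alternation false i).

(** * Nondeterministic finite automata *)

Record nfa (A : finType) := Nfa {
  state : finType;
  initial : {set state};
  final : {set state};
  trans : {set state * A * state} }.

Fixpoint accepts_from (A : finType) (M : nfa A) (p : state M) (w : seq A) :
    bool :=
  if w is a :: w' then
    [exists q : state M, ((p, a, q) \in trans M) && accepts_from q w']
  else p \in final M.

Definition recognized (A : finType) (M : nfa A) : language A :=
  fun w => [exists p in initial M, accepts_from p w].

(** * Algorithms *)

(** The total recursive functions of Kleene: the least class containing the
    constant zero, successor and projections, closed under composition,
    primitive recursion, and minimization whenever the latter yields a total
    function.  The last two closure conditions describe the new function [h]
    by its defining equations. *)
Inductive recursive : forall n : nat, (n.-tuple nat -> nat) -> Prop :=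
  | recursive_zero n : @recursive n (fun _ => 0)
  | recursive_succ : @recursive 1 (fun t => (tnth t ord0).+1)
  | recursive_proj n (i : 'I_n) : @recursive n (fun t => tnth t i)
  | recursive_comp m n (f : m.-tuple nat -> nat)
        (g : 'I_m -> n.-tuple nat -> nat) :
      recursive f -> (forall i, recursive (g i)) ->
      @recursive n (fun t => f [tuple g i t | i < m])
  | recursive_primrec n (f : n.-tuple nat -> nat) (g : n.+2.-tuple nat -> nat)
        (h : n.+1.-tuple nat -> nat) :
      recursive f -> recursive g ->
      (forall t : n.-tuple nat, h [tuple of 0 :: t] = f t) ->
      (forall x (t : n.-tuple nat), h [tuple of x.+1 :: t] =
         g [tuple of x :: h [tuple of x :: t] :: t]) ->
      recursive h
  | recursive_mu n (f : n.+1.-tuple nat -> nat) (h : n.-tuple nat -> nat) :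
      recursive f ->
      (forall t : n.-tuple nat, f [tuple of h t :: t] = 0) ->
      (forall (t : n.-tuple nat) x, x < h t -> f [tuple of x :: t] <> 0) ->
      recursive h.

(** An automaton is presented to an algorithm by numbering its states and
    letters and listing its components; [CodeSeq.code] is the bijection from
    [seq nat] to [nat] that sends [n :: s] to [2 ^ n * (2 * code s + 1)]. *)
Definition nfa_code (A : finType) (M : nfa A) : nat :=
  CodeSeq.code
    [:: #|state M|;
        CodeSeq.code [seq val (enum_rank p) | p <- enum (initial M)];
        CodeSeq.code [seq val (enum_rank p) | p <- enum (final M)];
        CodeSeq.code
          [seq CodeSeq.code [:: val (enum_rank t.1.1);
                                val (enum_rank t.1.2);
                                val (enum_rank t.2)]
          | t <- enum (trans M)]].

(** A single total recursive function answers all instances; the alphabet,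
    through its cardinality, is part of the input. *)
Definition algorithmically_decidable
    (P : forall A : finType, nfa A -> nfa A -> Prop) : Prop :=
  exists d : 3.-tuple nat -> nat,
    recursive d /\
    forall (A : finType) (M1 M2 : nfa A),
      let answer := d [tuple #|A|; nfa_code M1; nfa_code M2] in
      (P A M1 M2 -> answer = 1) /\ (~ P A M1 M2 -> answer = 0).

(* Main.v *)
(** Sigma_2(<) consists of the finite unions of products of letters and of
    languages [B*] with [B] a set of letters.  Give a word the type (letters,
    transition relation in [M1]), paired with a relation [S] on the states of
    [M2].  Let [J] be the least set of such triples that contains the triples of
    the empty word and of the letters, is closed under product, and contains
    [(B, R, S L S)] for each idempotent [(B, R, S)] in it, [L] being the relation
    of [B*] in [M2].  Then [L1] is separable from [L2] iff no triple of [J] has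
    [R] accepting in [M1] and [S] accepting in [M2].

    If such a triple exists, no sentence with given numbers of quantifiers
    separates: in the game for Sigma_2 sentences, [u^p] is below [u^p v u^p]
    for [p] large and [v] over the letters of [u], so for each triple in [J]
    there is one word realizing [(B, R)] below words realizing all pairs in [S].
    Conversely, Simon's factorization argument in the finite ordered monoid of
    triples, with long idempotent blocks [K ... K'] replaced by [K B* K'], covers
    every word by a product of bounded length whose relation in [M2] is the last
    component of a triple in [J] above the type of the word.

    The existence of a closed set of triples without bad triple is a bounded
    formula over the input numbers, triples and sets of triples being read as
    bit sets; so it is even decided by primitive recursion.  Pi_2 is dual. *)

Require Import Defs.
From mathcomp Require Import all_boot zify.
From Stdlib Require Import Classical ClassicalEpsilon FunctionalExtensionality.
Set Implicit Arguments.
Unset Strict Implicit.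
Unset Printing Implicit Defensive.

(** * Bounded factorization in finite ordered monoids *)

Section Factorization.

Variables (A T : finType) (mul : T -> T -> T) (one : T) (le : rel T)
  (beta : T -> T).
Hypotheses (mulA : associative mul) (mul1 : left_id one mul)
  (mulr1 : right_id one mul).
Hypotheses (le_anti : antisymmetric le) (le_refl : reflexive le)
  (le_mul : forall x y x' y', le x x' -> le y y' -> le (mul x y) (mul x' y')).

Local Notation "x * y" := (mul x y).

Definition power (x : T) n := iter n (mul x) one.

Lemma powerS x n : power x n.+1 = x * power x n.
Proof. by []. Qed.

Lemma power1 x : power x 1 = x.
Proof. exact: mulr1. Qed.

Lemma power_add x m n : power x (m + n) = power x m * power x n.
Proof. by elim: m => [|m IH]; rewrite ?mul1 //= -mulA -IH. Qed.

Lemma powerSr x n : power x n.+1 = power x n * x.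
Proof. by rewrite -addn1 power_add power1. Qed.

Lemma idempotent_power x : exists n, power x n.+1 * power x n.+1 = power x n.+1.
Proof.
have [i [j [ltij eqij]]] : exists i j, i < j /\ power x i = power x j.
  have /injectivePn[i [j /eqP neq eqij]] :
      ~~ injectiveb (fun i : 'I_#|T|.+1 => power x i).
    by apply/injectiveP=> /leq_card; rewrite card_ord ltnn.
  have {}neq : (i : nat) <> j by move/val_inj.
  by case: (ltngtP i j) neq => // ltij _; [exists i, j | exists j, i].
have per k m : i <= m -> power x (m + k * (j - i)) = power x m.
  move=> le_im; elim: k => [|k IH]; first by rewrite addn0.
  rewrite -[RHS]IH -(subnKC le_im).
  have -> : i + (m - i) + k.+1 * (j - i) = j + ((m - i) + k * (j - i)) by nia.
  by rewrite -addnA !power_add eqij.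
(* The exponent is a positive multiple of the period [j - i] and at least [i], so adding it to
   itself leaves the power unchanged. *)
have [n def_n] : exists n, n.+1 = (i.+1 * (j - i))%N.
  by exists (i.+1 * (j - i))%N.-1; nia.
exists n; rewrite def_n -power_add per //; nia.
Qed.

(** Green's J-preorder: [dvd x y] puts [x] below [y], and mutual [dvd] means lying in one
    J-class. *)
Definition dvd (x y : T) := [exists a, exists b, x == a * y * b].

Lemma dvdP x y : reflect (exists a b, x = a * y * b) (dvd x y).
Proof.
apply: (iffP existsP) => [[a /existsP[b /eqP ->]]|[a [b ->]]]; first by exists a, b.
by exists a; apply/existsP; exists b.
Qed.

Lemma dvd_refl : reflexive dvd.
Proof. by move=> x; apply/dvdP; exists one, one; rewrite mul1 mulr1. Qed.

Lemma dvd_trans : transitive dvd.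
Proof.
move=> y x z /dvdP[a [b ->]] /dvdP[c [d ->]]; apply/dvdP.
by exists (a * c), (d * b); rewrite !mulA.
Qed.

Lemma dvd_mull x y : dvd (x * y) y.
Proof. by apply/dvdP; exists x, one; rewrite mulr1. Qed.

Lemma dvd_mulr x y : dvd (x * y) x.
Proof. by apply/dvdP; exists one, y; rewrite mul1. Qed.

Lemma sandwich_power x a b n :
  x = a * x * b -> x = power a n.+1 * x * power b n.+1.
Proof.
move=> def_x; elim: n => [|n IH]; first by rewrite !power1.
by rewrite {1}def_x {1}IH [power a n.+2]powerS [power b n.+2]powerSr !mulA.
Qed.

(** Stability of finite monoids. Iterating [x = (a * z) * x * b] makes an idempotent power of
    [a * z] fix [x], and that power ends in [z]. *)
Lemma left_stable x z : dvd x (z * x) -> exists z', x = z' * (z * x).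
Proof.
case/dvdP=> a [b]; rewrite mulA => /sandwich_power def_x.
have [n] := idempotent_power (a * z); set p := power _ _ => idem.
have eq_x : p * x = x by rewrite {1}(def_x n) -/p mulA (mulA p) idem -def_x.
by exists (power (a * z) n * a); rewrite -[LHS]eq_x /p powerSr -!mulA.
Qed.

Lemma right_stable x z : dvd x (x * z) -> exists z', x = x * z * z'.
Proof.
case/dvdP=> a [b]; rewrite mulA -[a * x * z * b]mulA => /sandwich_power def_x.
have [n] := idempotent_power (z * b); set p := power _ _ => idem.
have eq_x : x * p = x by rewrite {1}(def_x n) -/p -mulA idem -def_x.
by exists (b * power (z * b) n); rewrite -[LHS]eq_x /p powerS !mulA.
Qed.

Hypotheses (le_beta : forall e, e * e = e -> le e (beta e))
  (mul_beta : forall e, e * e = e -> e * beta e = beta e)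
  (beta_mul : forall e, e * e = e -> beta e * e = beta e).

(* Inside its J-class, [beta e] lies in the group of [e]; an element of a
   finite ordered group that is at least the unit is the unit. *)
Lemma beta_fixed e : e * e = e -> dvd e (beta e) -> beta e = e.
Proof.
move=> ee; set g := beta e; have eg : e * g = g by apply: mul_beta.
have ge : g * e = g by apply: beta_mul.
have le_eg : le e g by apply: le_beta.
rewrite -{1}eg => /right_stable[c]; rewrite eg => def_e.
have power_e n : power g n.+1 * e = power g n.+1 by rewrite powerSr -mulA ge.
have quotient n : exists c', e = power g n.+1 * c'.
  elim: n => [|n [c' def_e']]; first by exists c; rewrite power1.
  by exists (c * c'); rewrite powerSr -mulA [g * _]mulA -def_e mulA power_e.
have [n idem] := idempotent_power g; have [c' def_e'] := quotient n.
have power_eq : power g n.+1 = e by rewrite -power_e def_e' mulA idem.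
(* Since [e] is below [g], the powers of [g] increase; as [e] is one of them, [g] is below [e]. *)
apply: le_anti; rewrite le_eg andbT -power_eq.
elim: (n) => [|k IH]; first by rewrite power1.
by rewrite -{1}eg powerS; apply: le_mul.
Qed.

Definition prod := foldr mul one.

Lemma prod_cat xs ys : prod (xs ++ ys) = prod xs * prod ys.
Proof. by elim: xs => [|x xs IH] /=; rewrite ?mul1 // IH mulA. Qed.

Lemma mem_ith ys i : i < size ys -> nth one ys i \in ys.
Proof. exact: mem_nth. Qed.

Definition seg (S : Type) i j (s : seq S) := drop i (take j s).

Lemma seg_cat (S : Type) i j k (s : seq S) :
  i <= j -> j <= k -> seg i j s ++ seg j k s = seg i k s.
Proof.
move=> le_ij le_jk; rewrite /seg -[RHS](cat_take_drop (j - i)).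
by rewrite take_drop drop_drop subnK // take_takel.
Qed.

Lemma seg0 (S : Type) j (s : seq S) : seg 0 j s = take j s.
Proof. by rewrite /seg drop0. Qed.

Lemma seg_nil (S : Type) j (s : seq S) : seg j j s = [::].
Proof. by apply: size0nil; rewrite size_drop size_take; case: ltnP; lia. Qed.

Lemma seg_size (S : Type) (s : seq S) : seg 0 (size s) s = s.
Proof. by rewrite seg0 take_size. Qed.

Lemma seg1 (S : Type) x0 i (s : seq S) :
  i < size s -> seg i i.+1 s = [:: nth x0 s i].
Proof.
move=> lt_is; rewrite /seg (take_nth x0) // -cats1 drop_size_cat //.
by rewrite size_take lt_is.
Qed.

Lemma prod_seg_first k l ys : k < l -> k < size ys ->
  prod (seg k l ys) = nth one ys k * prod (seg k.+1 l ys).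
Proof.
by move=> kl k_ys; rewrite -(seg_cat ys (leqnSn k) kl) (seg1 one) //= prod_cat /= mulr1.
Qed.

Lemma prod_seg_last k l ys : k <= l -> l < size ys ->
  prod (seg k l.+1 ys) = prod (seg k l ys) * nth one ys l.
Proof.
by move=> kl l_ys; rewrite -(seg_cat ys kl (leqnSn l)) (seg1 one) // prod_cat /= mulr1.
Qed.

Lemma seg_map (S S' : Type) (h : S -> S') i j s :
  seg i j (map h s) = map h (seg i j s).
Proof. by rewrite /seg map_drop map_take. Qed.

Lemma seg_catl (S : Type) i j (s t : seq S) :
  j <= size s -> seg i j (s ++ t) = seg i j s.
Proof. by move=> le_j; rewrite /seg takel_cat. Qed.

Lemma last_index (P : pred nat) k l :
  P k -> k < l ->
  exists m, [/\ k <= m < l, P m & forall i, m < i < l -> ~~ P i].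
Proof.
move=> Pk; elim: l => // l IH; rewrite ltnS leq_eqVlt => /orP[/eqP <-|lt_kl].
  by exists k; split=> // [|i]; lia.
have [Pl|nPl] := boolP (P l); first by exists l; split=> // [|i]; lia.
have [m [lt_ml Pm last_m]] := IH lt_kl.
exists m; split=> // [|i lt_i]; first by lia.
by have [-> //|ne_il] := eqVneq i l; apply: last_m; lia.
Qed.

(** * Evaluation of words within one J-class *)

Section Layer.

Variables (U : {set T}) (d : T).
Hypotheses (U_up : forall x y, dvd x y -> x \in U -> y \in U)
  (d_max : forall x, x \notin U -> dvd d x -> dvd x d).

(** For [d] outside [U], the layer is the J-class of [d], which is maximal among the classes outside
    [U]; [next_set] adjoins it to [U]. *)
Definition layer x := (x \notin U) && dvd d x.
Definition next_set := U :|: [set x | dvd d x].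

Lemma layer_dvd x y : layer x -> layer y -> dvd x y.
Proof.
by case/andP=> Ux dx /andP[_ dy]; apply: dvd_trans dy; apply: d_max.
Qed.

Lemma layer_between x y z : layer x -> layer z -> dvd x y -> dvd y z -> layer y.
Proof.
case/andP=> _ dx /andP[Uz _] xy yz; rewrite /layer (dvd_trans dx xy) andbT.
by apply: contra Uz; apply: U_up.
Qed.

Lemma next_up x y : dvd x y -> x \in next_set -> y \in next_set.
Proof.
move=> xy; rewrite !inE => /orP[Ux|dx]; first by rewrite (U_up xy).
by rewrite (dvd_trans dx xy) orbT.
Qed.

Definition smooth ys := all layer ys && ((ys == [::]) || layer (prod ys)).

(* Two cuts of one color enclose a factor that fixes the prefix before it and
   begins and ends with prescribed letters; such factors are one and the same
   idempotent of the layer ([cut_value]). *)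
Definition color ys k := (nth one ys k.-1, nth one ys k, prod (take k ys)).
Definition cut ys g k := (0 < k < size ys) && (color ys k == g).

(** In the J-preorder the product of a factor lies between the product of the whole sequence and any
    letter of the factor, and both ends are in the layer. *)
Lemma layer_seg ys i j :
  smooth ys -> i < j <= size ys -> layer (prod (seg i j ys)).
Proof.
case/andP=> /allP layers; case: eqP => [->|_ /= layer_ys /andP[lt_ij le_j]].
  by move=> _ /andP[lt_ij]; rewrite leqNgt (leq_ltn_trans _ lt_ij).
apply: layer_between layer_ys (layers (nth one ys i) _) _ _.
- by apply: mem_ith; lia.
- rewrite -{1}[ys](cat_take_drop j) -[take j ys]seg0.
  rewrite -(seg_cat _ (leq0n i) (ltnW lt_ij)) !prod_cat.
  exact: dvd_trans (dvd_mulr _ (prod (drop j ys))) (dvd_mull _ _).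
by rewrite prod_seg_first ?dvd_mulr //; lia.
Qed.

Lemma cut_value ys g i j i' j' :
  smooth ys -> i < j -> i' < j' ->
  cut ys g i -> cut ys g j -> cut ys g i' -> cut ys g j' ->
  let e := prod (seg i j ys) in e * e = e /\ prod (seg i' j' ys) = e.
Proof.
move=> sm lt_ij lt_ij' /andP[i_bd /eqP gi] /andP[j_bd /eqP gj].
case/andP=> [i'_bd /eqP gi'] /andP[j'_bd /eqP gj'].
set e := prod _; set e' := prod _; set y := nth one ys i; set p := prod (take i ys).
have layer_y: layer y by case/andP: sm => /allP + _; apply; apply: mem_ith; lia.
have absorb k l : k < l -> color ys k = g -> color ys l = g ->
    p * prod (seg k l ys) = p.
  rewrite -gi => lt_kl [_ _ eq_k] [_ _ eq_l].
  by rewrite /p -{1}eq_k -prod_cat -seg0 (seg_cat _ (leq0n k) (ltnW lt_kl)) seg0.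
(* By stability the letter just before a cut is a left multiple of [p], hence so is every factor
   that ends at a cut of this color. *)
have left k l : k < l -> l < size ys -> color ys l = g ->
    exists z, prod (seg k l ys) = z * p.
  rewrite -gi => lt_kl lt_l [eq_l _ _].
  have /left_stable[z def_y] :
      dvd (nth one ys i.-1) (prod (seg 0 i.-1 ys) * nth one ys i.-1).
    apply: layer_dvd; first by case/andP: sm => /allP + _; apply; apply: mem_ith; lia.
    rewrite -prod_seg_last //; last by lia.
    by apply: layer_seg => //; lia.
  rewrite -prod_seg_last // in def_y; last by lia.
  rewrite prednK in def_y; last by lia.
  rewrite -[l in seg k l](@prednK l) ?prod_seg_last; try lia.
  by rewrite eq_l def_y seg0 mulA; exists (prod (seg k l.-1 ys) * z).
have right k l : k < l -> l < size ys -> color ys k = g ->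
    exists z, prod (seg k l ys) = y * z.
  rewrite -gi => lt_kl lt_l [_ eq_k _].
  rewrite prod_seg_first //; last by lia.
  by rewrite eq_k; exists (prod (seg k.+1 l ys)).
have le_j : j < size ys by lia.
have le_j' : j' < size ys by lia.
have [z def_e] := left _ _ lt_ij le_j gj.
have [z' def_e'] := left _ _ lt_ij' le_j' gj'.
have pe : p * e = p by apply: absorb.
have pe' : p * e' = p by apply: absorb.
have ee' : e * e' = e by rewrite {1}/e def_e -mulA pe'.
have e'e : e' * e = e' by rewrite {1}/e' def_e' -mulA pe.
have [t def_t] := right _ _ lt_ij le_j gi.
have [t' def_t'] := right _ _ lt_ij' le_j' gi'.
(* [e'] begins with [y] and lies in its J-class, so stability makes [y], and with it [e], a right
   multiple of the idempotent [e']. Then [e' * e] equals [e] as well as [e']. *)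
have /right_stable[t2 def_y] : dvd y (y * t').
  by rewrite -def_t'; apply: layer_dvd => //; apply: layer_seg => //; lia.
split; first by rewrite {1}/e def_e -mulA pe.
have e'e' : e' * e' = e' by rewrite {1}/e' def_e' -mulA pe'.
have e_e' : e = e' * t2 * t by rewrite {1}/e def_t {1}def_y -def_t'.
by rewrite -[LHS]e'e e_e' !mulA e'e'.
Qed.

Section Evaluation.

(** [G n w x] reads: [w] evaluates to [x] at cost [n]. Arbitrarily many words with the same
    idempotent value are merged by a single application of [f], at the price of replacing [e] by
    [beta e]; this keeps costs independent of the length of the word. *)
Variables (G : nat -> seq A -> T -> Prop) (f : nat -> nat).
Hypotheses (f_ge : forall n, n <= f n)
  (G_mono : forall m n w x, m <= n -> G m w x -> G n w x)
  (G_nil : G 0 [::] one)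
  (G_cat : forall n u v x y, G n u x -> G n v y -> G (f n) (u ++ v) (x * y))
  (G_beta : forall n e us, e * e = e -> 1 < size us ->
     (forall u, u \in us -> G n u e) -> G (f n) (flatten us) (beta e)).

Implicit Types (z : seq (seq A * T)).

Definition valid H z := forall p, p \in z -> G H p.1 p.2.
Definition text z := flatten (unzip1 z).
Definition values z := unzip2 z.

(** Three cuts of one color enclose a repeated idempotent; when [beta] fixes it, [G_beta] evaluates
    any repetition without changing the value. *)
Definition stable ys := forall g a b c, a < b < c ->
  cut ys g a -> cut ys g b -> cut ys g c ->
  beta (prod (seg a b ys)) = prod (seg a b ys).

Lemma text_seg_cat i j k z : i <= j -> j <= k ->
  text (seg i j z) ++ text (seg j k z) = text (seg i k z).
Proof. by move=> ij jk; rewrite /text -flatten_cat -map_cat seg_cat. Qed.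

(** The segment is split at all its cuts of color [g], so no piece has such a cut inside. The last
    clause provides the third cut that stability asks for. *)
Lemma eval_chain z g n k l e :
  (forall a b, k <= a -> a < b -> b <= l -> cut (values z) g a ->
     cut (values z) g b -> prod (seg a b (values z)) = e) ->
  (forall a b, k <= a -> a < b -> b <= l ->
     (forall i, a < i < b -> ~~ cut (values z) g i) ->
     G n (text (seg a b z)) (prod (seg a b (values z)))) ->
  cut (values z) g k -> k <= l -> cut (values z) g l ->
  exists us, [/\ flatten us = text (seg k l z),
    forall u, u \in us -> G n u e, nilp us = (k == l) &
    1 < size us -> exists2 b, k < b < l & cut (values z) g b].
Proof.
move=> eq_e eval_e cut_k.
elim/ltn_ind: l => l IH in eq_e eval_e *.
rewrite leq_eqVlt => /orP[/eqP <- _|lt_kl cut_l].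
  by exists [::]; rewrite seg_nil eqxx.
have [m [/andP[le_km lt_ml] cut_m last_m]] := last_index cut_k lt_kl.
have [||us [flat_us eval_us nil_us size_us]] := IH m lt_ml _ _ le_km cut_m.
- by move=> a b ka ab bm; apply: eq_e => //; lia.
- by move=> a b ka ab bm; apply: eval_e => //; lia.
exists (rcons us (text (seg m l z))); split.
- by rewrite flatten_rcons flat_us text_seg_cat // ltnW.
- move=> u; rewrite mem_rcons inE => /orP[/eqP ->|/eval_us //].
  by rewrite -(eq_e m l) //; apply: eval_e.
- by rewrite /nilp size_rcons; case: eqP => // eq_kl; lia.
rewrite size_rcons ltnS lt0n [size us == 0]nil_us => ne_km.
by exists m => //; lia.
Qed.

(** Induction on the number of colors of inner cuts. With [g] the color of the first inner cut, the
    segment is split into its first letter, a chain up to the last cut of color [g], and a rest; the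
    rest and the pieces of the chain avoid [g] inside. Each color costs two concatenations and one
    merging, hence three applications of [f]. *)
Lemma eval_seg z n (C : {set T * T * T}) H i j :
  smooth (values z) -> stable (values z) -> valid H z -> #|C| <= n ->
  i <= j <= size z ->
  (forall k, i < k < j -> color (values z) k \in C) ->
  G (iter n (f \o f \o f) H) (text (seg i j z)) (prod (seg i j (values z))).
Proof.
move=> sm st Hz; have size_ys : size (values z) = size z by rewrite size_map.
have f3_ge m : m <= f (f (f m)).
  by rewrite (leq_trans (f_ge _)) // (leq_trans (f_ge _)).
elim: n C i j => [|n IH] C i j card_C /andP[le_ij le_j] colors.
all: move: le_ij; rewrite leq_eqVlt => /orP[/eqP <-|lt_ij];
  first by rewrite !seg_nil; apply: G_mono G_nil.
all: have eval1 : G H (text (seg i i.+1 z)) (prod (seg i i.+1 (values z))) by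
  rewrite seg_map (seg1 ([::], one)) /=;
  [rewrite /text /= cats0 mulr1; apply: Hz; rewrite mem_nth // (leq_trans lt_ij)
  | lia].
all: move: lt_ij; rewrite leq_eqVlt => /orP[/eqP <-|lt_ij].
- exact: eval1.
- by have := colors i.+1; move: card_C; rewrite leqn0 => /eqP/cards0_eq ->; rewrite inE; lia.
- apply: G_mono eval1; elim: (n.+1) => //= k le_k; exact: leq_trans (f3_ge _).
set g := color (values z) i.+1.
have cut_k : cut (values z) g i.+1 by rewrite /cut eqxx andbT size_ys; lia.
have [l [/andP[le_kl lt_lj] cut_l last_l]] := last_index cut_k lt_ij.
set m := iter n _ H in IH *; rewrite iterS -/m /=.
have evalC a b : i <= a -> a <= b -> b <= j ->
    (forall c, a < c < b -> ~~ cut (values z) g c) ->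
    G m (text (seg a b z)) (prod (seg a b (values z))).
  move=> ia ab bj ncut; apply: (IH (C :\ g)); first 1 last; try lia.
    move=> c lt_c; rewrite !inE colors ?andbT; last by lia.
    by apply: contra (ncut c lt_c) => eq_g; rewrite /cut eq_g size_ys; lia.
  by move: card_C; rewrite (cardsD1 g C) colors ?lt_ij ?ltnSn.
rewrite -(@text_seg_cat i l j) ?(ltnW lt_lj) //; last by lia.
rewrite -(@seg_cat _ i l j) ?(ltnW lt_lj) //; last by lia.
rewrite prod_cat; apply: G_cat; last first.
  by apply: G_mono (evalC l j _ _ _ last_l) => //; try lia; rewrite (leq_trans (f_ge _)).
rewrite -(@text_seg_cat i i.+1 l) // -(@seg_cat _ i i.+1 l) // prod_cat.
apply: G_cat.
  apply: G_mono (f_ge _) _; apply: evalC => //; try lia; move=> c; lia.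
move: le_kl; rewrite leq_eqVlt => /orP[/eqP <-|lt_kl].
  by rewrite !seg_nil; apply: G_mono G_nil.
set e := prod (seg i.+1 l (values z)).
have value_e a b : i.+1 <= a -> a < b -> b <= l -> cut (values z) g a ->
     cut (values z) g b -> e * e = e /\ prod (seg a b (values z)) = e.
  by move=> ia ab bl cut_a cut_b; apply: (cut_value sm lt_kl ab cut_k cut_l).
have [||us [<- eval_us nil_us size_us]] :=
  @eval_chain z g m i.+1 l e _ _ cut_k (ltnW lt_kl) cut_l.
- by move=> a b ia ab bl cut_a cut_b; case: (value_e a b).
- by move=> a b ia ab bl ncut; apply: evalC => //; lia.
case: us nil_us eval_us size_us => [|u [|u' us]] nil_us eval_us size_us.
- by move: nil_us; rewrite (ltn_eqF lt_kl).
- by rewrite /= cats0; apply: G_mono (f_ge _) _; apply: eval_us; rewrite mem_head.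
have [//|b lt_b cut_b] := size_us.
have [ee _] := value_e i.+1 l (leqnn _) lt_kl (leqnn _) cut_k cut_l.
(* At least two pieces mean three cuts of color [g], so stability applies and merging keeps the
   value [e]. *)
have <- : beta e = e.
  have [_ <-] := value_e i.+1 b (leqnn _) ltac:(lia) ltac:(lia) cut_k cut_b.
  exact: (st g _ _ l).
exact: G_beta.
Qed.

Lemma maximal_prefix (S : Type) (P : seq S -> Prop) s : P [::] ->
  P s \/ exists p c q, [/\ s = p ++ c :: q, P p & ~ P (p ++ [:: c])].
Proof.
elim/last_ind: s => [|s x IH] P0; first by left.
have [Ps|[p [c [q [-> Pp nPp]]]]] := IH P0; last first.
  by right; exists p, c, (rcons q x); rewrite rcons_cat.
have [|nP] := classic (P (rcons s x)); first by left.
by right; exists s, x, [::]; rewrite cats1.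
Qed.

(* A prefix that just stopped being smooth has left the layer by a product; one
   that just stopped being stable contains two consecutive factors with value
   an idempotent [e] such that [beta e] lies strictly below the layer. *)
Lemma escape z c K :
  (forall i j, i <= j -> j <= size z ->
     G K (text (seg i j z)) (prod (seg i j (values z)))) ->
  G K c.1 c.2 -> smooth (values z) -> c.2 \notin U ->
  ~ (smooth (values (z ++ [:: c])) /\ stable (values (z ++ [:: c]))) ->
  exists2 x, x \notin next_set & G (iter 4 f K) (text z ++ c.1) x.
Proof.
move=> evalK evalc sm_z Uc; set ys := values _ => nsm.
have def_ys : ys = values z ++ [:: c.2] by rewrite /ys /values /unzip2 map_cat.
have f_le k m : m <= iter k f m by elim: k => //= k; move/leq_trans; apply.
have [sm|nsmooth] := boolP (smooth ys); last first.
  exists (prod (values z) * c.2).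
    apply: contra nsmooth; rewrite 2!inE => next.
    have /negPf Ux : prod (values z) * c.2 \notin U.
      by apply: contra Uc; apply: U_up (dvd_mull _ _).
    rewrite Ux /= in next.
    rewrite /smooth def_ys all_cat prod_cat /= mulr1 andbT; apply/andP; split.
      case/andP: sm_z => -> _; rewrite /layer Uc.
      exact: dvd_trans next (dvd_mull _ _).
    by apply/orP; right; rewrite /layer Ux.
  apply: (G_mono (f_le 3 (f K))); apply: G_cat evalc.
  have := evalK 0 (size z) isT (leqnn _).
  by rewrite seg_size -[X in seg 0 X (values z)](size_map snd) seg_size.
have {nsm}[g [a [b [k]]]] : exists g a b k, [/\ a < b < k, cut ys g a, cut ys g b,
    cut ys g k & beta (prod (seg a b ys)) <> prod (seg a b ys)].
  apply: NNPP => none; case: nsm; split=> // g a b k lt_ab ca cb ck.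
  by apply: NNPP => ne; apply: none; exists g, a, b, k.
case=> /andP[lt_ab lt_bk] ca cb ck ne.
have [ee eq_e] := cut_value sm lt_ab lt_bk ca cb cb ck.
have size_ys : size ys = (size z).+1 by rewrite def_ys size_cat size_map addn1.
have le_k : k <= size z by case/andP: ck; rewrite size_ys; lia.
have segE i j : j <= size z -> seg i j ys = seg i j (values z).
  by move=> le_j; rewrite def_ys seg_catl ?size_map.
rewrite segE in ee eq_e ne; last by lia.
rewrite segE // in eq_e; set e := prod (seg a b (values z)) in ee eq_e ne.
have layer_e : layer e.
  by rewrite /e -segE; [apply: layer_seg; rewrite ?size_ys; lia | lia].
exists (prod (seg 0 a (values z)) * (beta e * (prod (seg k (size z) (values z)) * c.2))).
  (* [beta e] is below [e], hence not in [U]; in the layer, [beta_fixed] would make it equal to [e],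
     against the choice of the cuts. *)
  have escape_beta : beta e \notin next_set.
    case/andP: layer_e => Ue de; rewrite !inE negb_or; apply/andP; split.
      by apply: contra Ue; apply: U_up; rewrite -beta_mul // dvd_mull.
    by apply/negP => /(dvd_trans (d_max Ue de)) /(beta_fixed ee).
  apply: contra escape_beta; apply: next_up.
  exact: dvd_trans (dvd_mull _ _) (dvd_mulr _ _).
have -> : text z = text (seg 0 a z) ++ (text (seg a b z) ++ text (seg b k z))
      ++ text (seg k (size z) z).
  rewrite text_seg_cat ?(ltnW lt_ab) ?(ltnW lt_bk) // !text_seg_cat ?seg_size //; lia.
rewrite -!catA; apply: G_cat.
  by apply: (G_mono (f_le 3 K)); apply: evalK; lia.
rewrite catA; apply: G_cat.
  have -> : text (seg a b z) ++ text (seg b k z) =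
      flatten [:: text (seg a b z); text (seg b k z)] by rewrite /= cats0.
  apply: (G_mono (f_le 1 (f K))); apply: G_beta => // u; rewrite !inE.
  case/orP=> /eqP ->; first by apply: evalK; lia.
  by rewrite -eq_e; apply: evalK; lia.
apply: (G_mono (f_le 1 (f K))); apply: G_cat evalc; apply: evalK => //.
Qed.

(** Greedy reading of [z]: a maximal prefix that is smooth and stable has bounded cost, and together
    with the next block it escapes the layer by [escape]. This is repeated on what follows; only the
    last piece may fail to escape. *)
Lemma layer_step H : exists K, forall z, valid H z ->
  (forall p, p \in z -> p.2 \notin U) ->
  exists z' v y, [/\ text z = text z' ++ v, valid K z',
    forall p, p \in z' -> p.2 \notin next_set & G K v y].
Proof.
(* One round of three applications of [f] for each possible color. *)
set K := iter #|[set: T * T * T]| (f \o f \o f) H.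
have le_HK : H <= K.
  rewrite /K; elim: #|_| => //= n /leq_trans; apply.
  by rewrite (leq_trans (f_ge _)) // (leq_trans (f_ge _)).
have f_le k m : m <= iter k f m by elim: k => //= k; move/leq_trans; apply.
exists (iter 4 f K) => z; have [n] := ubnP (size z).
elim: n z => // n IH z lt_n Hz Uz.
have evalK p : smooth (values p) -> stable (values p) -> valid H p ->
    forall i j, i <= j -> j <= size p ->
    G K (text (seg i j p)) (prod (seg i j (values p))).
  move=> sm st Hp i j le_ij le_j; apply: (eval_seg (C := setT)) => // [|k _].
    by rewrite le_ij.
  by rewrite inE.
have good0 : smooth (values [::]) /\ stable (values [::]).
  by split=> // g a b k _; rewrite /cut /= ltn0 andbF.
have [[sm_z st_z]|[p [c [q [def_z [sm st] nsm]]]]] :=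
  maximal_prefix (P := fun p => smooth (values p) /\ stable (values p)) z good0.
  exists [::], (text z), (prod (values z)); split=> //.
  apply: (G_mono (f_le 4 K)).
  have := evalK z sm_z st_z Hz 0 (size z) isT (leqnn _).
  by rewrite seg_size -[X in seg 0 X (values z)](size_map snd) seg_size.
have Hp : valid H p by move=> i pi; apply: Hz; rewrite def_z mem_cat pi.
have c_z : c \in z by rewrite def_z mem_cat mem_head orbT.
have q_z i : i \in q -> i \in z by rewrite def_z mem_cat inE => ->; rewrite !orbT.
have [x Ux evalx] := escape (evalK p sm st Hp) (G_mono le_HK (Hz c c_z)) sm (Uz c c_z) nsm.
have [|i /q_z/Hz //|i /q_z/Uz //|z' [v [y [eq_q Hz' Uz' Gv]]]] := IH q.
  by move: lt_n; rewrite def_z size_cat /=; lia.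
exists ((text p ++ c.1, x) :: z'), v, y; split=> //.
- by rewrite def_z /text /unzip1 map_cat flatten_cat /= -/(text q) eq_q -!catA.
- by move=> i; rewrite inE => /orP[/eqP -> //|]; apply: Hz'.
- by move=> i; rewrite inE => /orP[/eqP -> //|]; apply: Uz'.
Qed.

End Evaluation.

End Layer.

(** * Exhausting the J-classes from the top *)

Section BoundedFactorization.

Variables (val : A -> T) (G : nat -> seq A -> T -> Prop) (f : nat -> nat).
Hypotheses (f_ge : forall n, n <= f n)
  (G_mono : forall m n w x, m <= n -> G m w x -> G n w x)
  (G_nil : G 0 [::] one) (G_letter : forall a, G 1 [:: a] (val a))
  (G_cat : forall n u v x y, G n u x -> G n v y -> G (f n) (u ++ v) (x * y))
  (G_beta : forall n e us, e * e = e -> 1 < size us ->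
     (forall u, u \in us -> G n u e) -> G (f n) (flatten us) (beta e)).

(* All blocks but the last have values outside [U]; as [U] grows to the whole
   monoid, only the last block remains. *)
Definition splits (U : {set T}) := exists H, forall w, exists z v y,
  [/\ w = text z ++ v, valid G H z, forall p, p \in z -> p.2 \notin U & G H v y].

Lemma splits_set0 : splits set0.
Proof.
exists 1 => w; exists [seq ([:: a], val a) | a <- w], [::], one; split.
- by rewrite cats0; elim: w => //= a w {1}->.
- by move=> p /mapP[a _ ->]; apply: G_letter.
- by move=> p _; rewrite inE.
- exact: (G_mono (leq0n 1)).
Qed.

Lemma splits_next (U : {set T}) d :
  (forall x y, dvd x y -> x \in U -> y \in U) ->
  (forall x, x \notin U -> dvd d x -> dvd x d) ->
  splits U -> splits (next_set U d).
Proof.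
move=> U_up d_max [H splitU].
have [K stepK] := layer_step U_up d_max f_ge G_mono G_nil G_cat G_beta H.
exists (f (maxn H K)) => w; have [z [v [y [-> Hz Uz Gv]]]] := splitU w.
have [z' [v' [y' [-> Kz' Uz' Gv']]]] := stepK z Hz Uz.
have le_K : K <= f (maxn H K) by rewrite (leq_trans (leq_maxr H K)).
exists z', (v' ++ v), (y' * y); rewrite catA; split=> //.
  by move=> p /Kz'; apply: G_mono.
by apply: G_cat; [apply: G_mono Gv'|apply: G_mono Gv]; rewrite ?leq_maxl ?leq_maxr.
Qed.

Theorem bounded_factorization : exists H, forall w, exists x, G H w x.
Proof.
suff [H splitT] : splits setT.
  exists H => w; have [[|p z] [v [y [-> _ Uz Gv]]]] := splitT w; first by exists y.
  by have := Uz p (mem_head _ _); rewrite inE.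
suff grow n (U : {set T}) : #|~: U| <= n -> (forall x y, dvd x y -> x \in U -> y \in U) ->
    splits U -> splits setT.
  apply: (grow _ set0 (leqnn _)); last exact: splits_set0.
  by move=> x y _; rewrite inE.
elim: n U => [|n IH] U.
  rewrite leqn0 => /eqP/cards0_eq/(congr1 (@setC _)); rewrite setCK setC0 => -> //.
have [/eqP U0 _ _|/set0Pn[d0 Ud0] cardU U_up] := boolP (~: U == set0).
  by rewrite -[U]setCK U0 setC0.
(* An element outside [U] with the fewest divisors is J-maximal there: a divisor of it outside [U]
   has no fewer divisors, hence the same ones. *)
pose d := [arg min_(x < d0 in ~: U) #|[set y | dvd x y]|].
have [Ud min_d] : d \in ~: U /\ forall x, x \in ~: U ->
    #|[set y | dvd d y]| <= #|[set y | dvd x y]|.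
  by rewrite /d; case: arg_minnP.
have d_max x : x \notin U -> dvd d x -> dvd x d.
  move=> Ux dx; have sub : [set y | dvd x y] \subset [set y | dvd d y].
    by apply/subsetP=> y; rewrite !inE; apply: dvd_trans.
  have /eqP/setP/(_ d) : [set y | dvd x y] == [set y | dvd d y].
    by rewrite eqEcard sub min_d // inE.
  by rewrite !inE dvd_refl.
move=> /(splits_next U_up d_max); apply: IH; last by move=> x y; apply: next_up.
rewrite -ltnS (leq_trans _ cardU) //; apply: proper_card; apply/properP; split.
  by rewrite setCS subsetUl.
by exists d => //; rewrite !inE dvd_refl orbT.
Qed.

End BoundedFactorization.

End Factorization.
(** * Types of words *)

Section Relations.

Variables (A : finType) (M : nfa A).
Local Notation Q := (state M).
Local Notation rel := {set Q * Q}.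

Definition rel_id : rel := [set pq | pq.1 == pq.2].
Definition rel_comp (R S : rel) : rel :=
  [set pq | [exists r, ((pq.1, r) \in R) && ((r, pq.2) \in S)]].
Definition rel_letter (a : A) : rel := [set pq | (pq.1, a, pq.2) \in trans M].
Definition rel_word (w : seq A) : rel :=
  foldr (fun a R => rel_comp (rel_letter a) R) rel_id w.
Definition rel_star (B : {set A}) : rel :=
  [set pq | connect (fun r s => [exists a in B, (r, a, s) \in trans M]) pq.1 pq.2].

Lemma rel_compP (R S : rel) p q :
  reflect (exists2 r, (p, r) \in R & (r, q) \in S) ((p, q) \in rel_comp R S).
Proof.
by rewrite inE; apply: (iffP existsP) => [[r /andP[]]|[r pr rq]];
  exists r => //; rewrite pr.
Qed.

Lemma rel_compA : associative rel_comp.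
Proof.
move=> R S U; apply/setP=> -[p q]; apply/rel_compP/rel_compP => [].
  by case=> r pr /rel_compP[s rs sq]; exists s => //; apply/rel_compP; exists r.
by case=> s /rel_compP[r pr rs] sq; exists r => //; apply/rel_compP; exists s.
Qed.

Lemma rel_comp1 : left_id rel_id rel_comp.
Proof.
move=> R; apply/setP=> -[p q]; apply/rel_compP/idP => [[r]|pq].
  by rewrite inE => /eqP /= ->.
by exists p => //; rewrite inE.
Qed.

Lemma rel_compr1 : right_id rel_id rel_comp.
Proof.
move=> R; apply/setP=> -[p q]; apply/rel_compP/idP => [[r pr]|pq].
  by rewrite inE => /eqP /= <-.
by exists q => //; rewrite inE.
Qed.

Lemma rel_compS (R R' S S' : rel) :
  R \subset R' -> S \subset S' -> rel_comp R S \subset rel_comp R' S'.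
Proof.
move=> /subsetP subR /subsetP subS; apply/subsetP=> -[p q] /rel_compP[r pr rq].
by apply/rel_compP; exists r; [apply: subR|apply: subS].
Qed.

Lemma rel_word_cat u v : rel_word (u ++ v) = rel_comp (rel_word u) (rel_word v).
Proof. by elim: u => [|a u IH] /=; rewrite ?rel_comp1 // IH rel_compA. Qed.

Lemma rel_word1 a : rel_word [:: a] = rel_letter a.
Proof. exact: rel_compr1. Qed.

Lemma recognizedP w :
  recognized M w <->
  exists p q, [/\ p \in initial M, q \in final M & (p, q) \in rel_word w].
Proof.
have acceptsP p : accepts_from p w <->
    exists2 q, q \in final M & (p, q) \in rel_word w.
  elim: w p => [|a w IH] p /=.
    split=> [fin_p|[q fin_q]]; first by exists p => //; rewrite inE.
    by rewrite inE => /eqP /= ->.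
  split=> [/existsP[r /andP[par /IH[q fin_q rq]]]|[q fin_q /rel_compP[r]]].
    by exists q => //; apply/rel_compP; exists r; rewrite // inE.
  rewrite inE => par rq; apply/existsP; exists r; rewrite par /=.
  by apply/IH; exists q.
rewrite /recognized; split=> [/existsP[p /andP[ini_p /acceptsP[q fin_q pq]]]|].
  by exists p, q.
case=> p [q [ini_p fin_q pq]]; apply/existsP; exists p; rewrite ini_p.
by apply/acceptsP; exists q.
Qed.

Lemma rel_starP (B : {set A}) p q :
  reflect (exists2 v, all (mem B) v & (p, q) \in rel_word v) ((p, q) \in rel_star B).
Proof.
rewrite inE; apply: (iffP connectP) => [[s]|[v]] /=.
  elim: s p => [|r s IH] p /=; first by move=> _ ->; exists [::]; rewrite //= inE.
  case/andP=> /exists_inP[a Ba par] /IH{}IH /IH[v Bv rq].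
  exists (a :: v); first by rewrite /= Ba.
  by apply/rel_compP; exists r; rewrite // inE.
elim: v p => [|a v IH] p /=; first by move=> _; rewrite inE => /eqP /= ->; exists [::].
case/andP=> Ba Bv /rel_compP[r]; rewrite inE => par /(IH _ Bv)[s r_s ->].
by exists (r :: s) => //=; rewrite r_s andbT; apply/exists_inP; exists a.
Qed.

Lemma rel_star_id B : rel_id \subset rel_star B.
Proof.
apply/subsetP=> -[p q] pq; apply/rel_starP; by exists [::].
Qed.

Definition rel_pump B (R : rel) := rel_comp (rel_comp R (rel_star B)) R.

Lemma rel_pump_sub B (R : rel) : rel_comp R R = R -> R \subset rel_pump B R.
Proof.
move=> RR; rewrite -{1}RR; apply: rel_compS => //.
by rewrite -{1}[R]rel_compr1; apply: rel_compS => //; apply: rel_star_id.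
Qed.

End Relations.

(** * The ordered monoid of types *)

Section Types.

Variables (A : finType) (M1 M2 : nfa A).

Definition wtype : finType :=
  ({set A} * {set state M1 * state M1} * {set state M2 * state M2})%type.

Definition wtype_mul (x y : wtype) : wtype :=
  (x.1.1 :|: y.1.1, rel_comp x.1.2 y.1.2, rel_comp x.2 y.2).
Definition wtype_one : wtype := (set0, rel_id M1, rel_id M2).
Definition wtype_letter a : wtype := ([set a], rel_letter M1 a, rel_letter M2 a).
Definition wtype_pump (e : wtype) : wtype := (e.1, rel_pump e.1.1 e.2).
Definition wtype_le (x y : wtype) := (x.1 == y.1) && (x.2 \subset y.2).

Lemma wtype_mulA : associative wtype_mul.
Proof. by move=> x y z; rewrite /wtype_mul /= setUA !rel_compA. Qed.

Lemma wtype_mul1 : left_id wtype_one wtype_mul.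
Proof. by case=> [[B R] S]; rewrite /wtype_mul /= set0U !rel_comp1. Qed.

Lemma wtype_mulr1 : right_id wtype_one wtype_mul.
Proof. by case=> [[B R] S]; rewrite /wtype_mul /= setU0 !rel_compr1. Qed.

Lemma wtype_le_anti : antisymmetric wtype_le.
Proof.
move=> [x S] [y U] /andP[/andP[/= /eqP -> SU] /andP[_ US]].
by congr (_, _); apply/eqP; rewrite eqEsubset SU.
Qed.

Lemma wtype_le_mul x y x' y' :
  wtype_le x x' -> wtype_le y y' -> wtype_le (wtype_mul x y) (wtype_mul x' y').
Proof.
case/andP=> /eqP eqx subx /andP[/eqP eqy suby].
by rewrite /wtype_le /= eqx eqy eqxx rel_compS.
Qed.

Lemma wtype_idemP e : wtype_mul e e = e ->
  rel_comp e.1.2 e.1.2 = e.1.2 /\ rel_comp e.2 e.2 = e.2.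
Proof. by case: e => [[B R] S] [_ -> ->]. Qed.

Lemma wtype_le_pump e : wtype_mul e e = e -> wtype_le e (wtype_pump e).
Proof. by move=> /wtype_idemP[_ SS]; rewrite /wtype_le eqxx rel_pump_sub. Qed.

Lemma wtype_mul_pump e :
  wtype_mul e e = e -> wtype_mul e (wtype_pump e) = wtype_pump e.
Proof.
case: e => [[B R] S] /wtype_idemP /= [RR SS].
by rewrite /wtype_mul /wtype_pump /= /rel_pump setUid RR !rel_compA SS.
Qed.

Lemma wtype_pump_mul e :
  wtype_mul e e = e -> wtype_mul (wtype_pump e) e = wtype_pump e.
Proof.
case: e => [[B R] S] /wtype_idemP /= [RR SS].
by rewrite /wtype_mul /wtype_pump /= /rel_pump setUid RR -!rel_compA SS.
Qed.

(** The least saturated set is safe as soon as some saturated set is, so the criterion may range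
    over all saturated sets. *)
Definition saturated (J : {set wtype}) :=
  [/\ wtype_one \in J, forall a, wtype_letter a \in J,
      forall x y, x \in J -> y \in J -> wtype_mul x y \in J &
      forall e, e \in J -> wtype_mul e e = e -> wtype_pump e \in J].

Definition meets (M : nfa A) (R : {set state M * state M}) :=
  [exists p in initial M, exists q in final M, (p, q) \in R].

Definition safe (J : {set wtype}) :=
  forall x, x \in J -> meets x.1.2 -> meets x.2 -> False.

Lemma recognized_meets (M : nfa A) w : recognized M w <-> meets (rel_word M w).
Proof.
split=> [/recognizedP[p [q [ip fq pq]]]|/exists_inP[p ip /exists_inP[q fq pq]]].
  by apply/exists_inP; exists p => //; apply/exists_inP; exists q.
by apply/recognizedP; exists p, q.
Qed.

End Types.

Definition alph (A : finType) (w : seq A) : {set A} := [set a in w].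

Lemma alph_cat (A : finType) (u v : seq A) : alph (u ++ v) = alph u :|: alph v.
Proof. by apply/setP=> a; rewrite !inE mem_cat. Qed.

(** * Games for quantifier prefixes *)

Section Games.

Variable A : finType.
Implicit Types (u v w : seq A) (e : nat -> option nat) (s : bitseq).

(* Partial environments make games compose under concatenation: a variable
   placed in one factor is undefined in the other. *)
Definition env0 : nat -> option nat := fun _ => None.

Definition agree w e w' e' :=
  (forall x, match e x, e' x with
    | Some i, Some i' =>
        [/\ i < size w, i' < size w' & onth w i = onth w' i']
    | None, None => True
    | _, _ => False
    end) /\
  (forall x y i j i' j', e x = Some i -> e y = Some j ->
    e' x = Some i' -> e' y = Some j' -> (i < j) = (i' < j')).

(** An Ehrenfeucht-Fraisse game for a fixed prefix: Spoiler moves in [w] at [true] and in [w'] at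
    [false], so truth passes from [w] to [w']. In each round the pebble may also stay unplaced; this
    is how one factor of a concatenation sees a move made in the other. *)
Fixpoint game s w e w' e' : Prop :=
  if s is b :: s' then
    game s' w (scons None e) w' (scons None e') /\
    (if b then forall i, i < size w -> exists2 i', i' < size w' &
        game s' w (scons (Some i) e) w' (scons (Some i') e')
     else forall i', i' < size w' -> exists2 i, i < size w &
        game s' w (scons (Some i) e) w' (scons (Some i') e'))
  else agree w e w' e'.

Definition in_range w e := forall x i, e x = Some i -> i < size w.

Lemma scons_env0 : scons None env0 = env0.
Proof. by apply: functional_extensionality; case. Qed.

Lemma game_refl s w e : in_range w e -> game s w e w e.
Proof.
elim: s e => [|b s IH] e ew /=.
  split=> [x|x y i j i' j' -> -> [->] [->] //].
  by case def_i: (e x) => [i|] //; have := ew x i def_i.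
split; first by apply: IH => -[|x] i //=; apply: ew.
by case: b => i lt_i; exists i => //; apply: IH => -[|x] j /= => [[<-]|/ew].
Qed.

Definition join k (e1 e2 : nat -> option nat) x :=
  if e1 x is Some i then Some i else omap (addn k) (e2 x).

Lemma join_scons k e1 e2 o1 o2 :
  scons (if o1 is Some i then Some i else omap (addn k) o2) (join k e1 e2)
  = join k (scons o1 e1) (scons o2 e2).
Proof. by apply: functional_extensionality; case. Qed.

Lemma join_env0 k : join k env0 env0 = env0.
Proof. exact: functional_extensionality. Qed.

Lemma onth_catr (u v : seq A) i : onth (u ++ v) (size u + i) = onth v i.
Proof. by rewrite onth_cat ltnNge leq_addr /= addKn. Qed.

(** A move is answered in the factor where it falls, while the other factor plays an unplaced
    pebble. *)
Lemma game_cat s u e1 u' e1' v e2 v' e2' :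
  game s u e1 u' e1' -> game s v e2 v' e2' ->
  game s (u ++ v) (join (size u) e1 e2) (u' ++ v') (join (size u') e1' e2').
Proof.
elim: s e1 e1' e2 e2' => [|b s IH] e1 e1' e2 e2' /=.
  case=> val1 ord1 [val2 ord2]; split=> [x|x y i j i' j'].
    rewrite /join !size_cat; case: (e1 x) (e1' x) (val1 x) => [i|] [i'|] //.
      by case=> lt_i lt_i' eq_i; rewrite !onth_cat lt_i lt_i' eq_i; split=> //; lia.
    move=> _; case: (e2 x) (e2' x) (val2 x) => [i|] [i'|] //= [lt_i lt_i' eq_i].
    by rewrite !onth_catr eq_i !ltn_add2l.
  move: (ord1 x y) (ord2 x y); rewrite /join.
  case: (e1 x) (e1' x) (val1 x) => [ix|] [ix'|] // valx;
  case: (e1 y) (e1' y) (val1 y) => [iy|] [iy'|] // valy o1 o2.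
  - by move=> [<-] [<-] [<-] [<-]; apply: o1.
  - case: valx => lx lx' _; case: (e2 y) (e2' y) => [jy|] [jy'|] //= [<-] [<-] [<-] [<-]; lia.
  - case: valy => ly ly' _; case: (e2 x) (e2' x) => [jx|] [jx'|] //= [<-] [<-] [<-] [<-]; lia.
  case: (e2 x) (e2' x) o2 => [jx|] [jx'|] //;
  case: (e2 y) (e2' y) => [jy|] [jy'|] // o2 [<-] [<-] [<-] [<-].
  by rewrite !ltn_add2l; apply: o2.
case=> none1 move1 [none2 move2]; split.
  by have := IH _ _ _ _ none1 none2; rewrite -!join_scons.
case: b move1 move2 => move1 move2 i; rewrite size_cat => lt_i.
  case: (ltnP i (size u)) => [lt_iu|le_ui].
    have [i' lt_i' game1] := move1 i lt_iu; exists i'; first by rewrite size_cat ltn_addr.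
    by have := IH _ _ _ _ game1 none2; rewrite -!join_scons.
  have [|i' lt_i' game2] := move2 (i - size u); first by lia.
  exists (size u' + i'); first by rewrite size_cat ltn_add2l.
  by have := IH _ _ _ _ none1 game2; rewrite -!join_scons /= subnKC.
case: (ltnP i (size u')) => [lt_iu|le_ui].
  have [i' lt_i' game1] := move1 i lt_iu; exists i'; first by rewrite size_cat ltn_addr.
  by have := IH _ _ _ _ game1 none2; rewrite -!join_scons.
have [|i' lt_i' game2] := move2 (i - size u'); first by lia.
exists (size u + i'); first by rewrite size_cat ltn_add2l.
by have := IH _ _ _ _ none1 game2; rewrite -!join_scons /= subnKC.
Qed.

Lemma game_cat0 s u u' v v' : game s u env0 u' env0 -> game s v env0 v' env0 ->
  game s (u ++ v) env0 (u' ++ v') env0.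
Proof. by move=> gu gv; have := game_cat gu gv; rewrite !join_env0. Qed.

Lemma game_pebble s u u' v w w' j : j < size v ->
  game s u env0 u' env0 -> game s w env0 w' env0 ->
  game s (u ++ v ++ w) (scons (Some (size u + j)) env0)
    (u' ++ v ++ w') (scons (Some (size u' + j)) env0).
Proof.
move=> lt_j gu gw.
have gv : game s v (scons (Some j) env0) v (scons (Some j) env0).
  by apply: game_refl => -[|x] i //= [<-].
have env_eq k l : join k env0 (join l (scons (Some j) env0) env0)
    = scons (Some (k + j)) env0 by apply: functional_extensionality; case.
by have := game_cat gu (game_cat gv gw); rewrite !env_eq.
Qed.

(** * Powers that absorb words over their letters *)

Definition wpow u n := flatten (nseq n u).

Lemma wpow_add u m n : wpow u (m + n) = wpow u m ++ wpow u n.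
Proof. by rewrite /wpow nseqD flatten_cat. Qed.

Lemma wpow_split u p c : c < p -> wpow u p = wpow u c ++ u ++ wpow u (p - c.+1).
Proof.
move=> lt_c; have last : wpow u c.+1 = wpow u c ++ u.
  by rewrite -addn1 wpow_add /wpow /= cats0.
by rewrite -{1}(subnKC lt_c) wpow_add last -catA.
Qed.

Lemma size_wpowS u n : size (wpow u n.+1) = size u + size (wpow u n).
Proof. by rewrite /wpow /= size_cat. Qed.

Lemma wpow_index u p i : i < size (wpow u p) ->
  exists c j, [/\ c < p, j < size u & i = size (wpow u c) + j].
Proof.
elim: p i => // p IH i; rewrite size_wpowS => lt_i.
case: (ltnP i (size u)) => [lt_iu|le_ui]; first by exists 0, i.
have [|c [j [lt_c lt_j eq_i]]] := IH (i - size u); first by lia.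
by exists c.+1, j; split=> //; rewrite size_wpowS; lia.
Qed.

Fixpoint univ_bound m := if m is m'.+1 then (univ_bound m').*2.+1 else 0.

(** A letter of [v] occurs in [u] and is answered in a copy of [u] that has [univ_bound m] copies on
    either side, one side for each remaining part of [v]; hence the doubling plus one. The contexts
    [x] and [y] take up the leftovers. *)
Lemma game_universal m p u x y v : {subset v <= u} -> univ_bound m <= p ->
  game (nseq m false) (x ++ wpow u p ++ y) env0 v env0.
Proof.
elim: m p x y v => [|m IH] p x y v sub_vu /= le_p; first by [].
rewrite scons_env0; split=> [|i lt_i]; first by apply: IH => //; lia.
have [v1 [a [v2 [def_v size_v1]]]] : exists v1 a v2, v = v1 ++ a :: v2 /\ size v1 = i.
  case: v lt_i {sub_vu} => // a0 v lt_i.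
  exists (take i (a0 :: v)), (nth a0 (a0 :: v) i), (drop i.+1 (a0 :: v)).
  by rewrite -drop_nth // cat_take_drop size_takel // ltnW.
have /splitPr def_u : a \in u by apply: sub_vu; rewrite def_v mem_cat mem_head orbT.
case: u / def_u => u1 u2 in IH sub_vu le_p *; set u := u1 ++ _ in IH sub_vu le_p *.
set c := univ_bound m; have lt_c : c < p by rewrite /c; lia.
have sub1 : {subset v1 <= u} by move=> b bv; apply: sub_vu; rewrite def_v mem_cat bv.
have sub2 : {subset v2 <= u}.
  by move=> b bv; apply: sub_vu; rewrite def_v mem_cat inE bv !orbT.
exists (size ((x ++ wpow u c) ++ u1) + 0).
  by rewrite (wpow_split u lt_c) !size_cat /=; lia.
have -> : x ++ wpow u p ++ y =
    ((x ++ wpow u c) ++ u1) ++ [:: a] ++ (u2 ++ wpow u (p - c.+1) ++ y).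
  by rewrite (wpow_split u lt_c) /u -!catA.
rewrite def_v -size_v1 -[size v1]addn0 -[a :: v2]/([:: a] ++ v2).
apply: game_pebble => //; first by rewrite -catA; apply: IH.
by apply: IH => //; rewrite /c; lia.
Qed.

Fixpoint pump_bound n m :=
  if n is n'.+1 then 3 * (pump_bound n' m) + 1 else univ_bound m.

(** A move with fewer than [k] copies of [u] after it is answered in the last power, with equally
    many copies after it; any other move is answered in the first power. On each side of the
    answered copy the words are either equal or again in the situation of the induction
    hypothesis. *)
Lemma game_pump n m p p1 p2 u v : {subset v <= u} ->
  pump_bound n m <= p -> pump_bound n m <= p1 -> pump_bound n m <= p2 ->
  game (nseq n true ++ nseq m false) (wpow u p) env0
    (wpow u p1 ++ v ++ wpow u p2) env0.
Proof.
move=> sub_vu; elim: n p p1 p2 v sub_vu => [|n IH] p p1 p2 v sub_vu /=.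
  move=> le_p _ _; rewrite -[wpow u p]cat0s -[wpow u p]cats0.
  have subpow k : {subset wpow u k <= u}.
    by move=> a /flattenP[_ /nseqP[-> _]].
  apply: game_universal => // a; rewrite !mem_cat.
  by case/or3P => [/subpow|/sub_vu|/subpow].
set k := pump_bound n m in IH * => le_p le_p1 le_p2; rewrite scons_env0.
split=> [|i]; first by apply: IH => //; lia.
case/wpow_index=> c [j [lt_c lt_j ->]]; rewrite (wpow_split u lt_c).
have refl0 w : game (nseq n true ++ nseq m false) w env0 w env0 by apply: game_refl.
have [le_k|lt_k] := leqP k (p - c.+1); last first.
  exists (size (wpow u p1 ++ v ++ wpow u (p2 - (p - c.+1).+1)) + j).
    by rewrite (@wpow_split u p2 (p2 - (p - c.+1).+1)) ?size_cat; lia.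
  have -> : wpow u p1 ++ v ++ wpow u p2 =
      (wpow u p1 ++ v ++ wpow u (p2 - (p - c.+1).+1)) ++ u ++ wpow u (p - c.+1).
    rewrite (@wpow_split u p2 (p2 - (p - c.+1).+1)) ?subKn -?catA //; last by lia.
    by congr (_ ++ (_ ++ (_ ++ (_ ++ wpow u _)))); lia.
  by apply: game_pebble => //; apply: IH => //; lia.
have [c' [lt_c' le_k' gamec]] : exists c', [/\ c' < p1, k <= p1 - c'.+1 &
    game (nseq n true ++ nseq m false) (wpow u c) env0 (wpow u c') env0].
  have [lt_ck|le_kc] := ltnP c k; first by exists c; split=> //; lia.
  (* A long left part is matched with [2 * k] copies, seen as two powers around the empty word;
     [p1 >= 3 * k + 1] then leaves [k] copies after the answer. *)
  exists (k + k); split; try lia.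
  by rewrite wpow_add -[wpow u k ++ _]/(wpow u k ++ [::] ++ _); apply: IH.
exists (size (wpow u c') + j).
  by rewrite (wpow_split u lt_c') !size_cat; lia.
rewrite (wpow_split u lt_c') -!catA; apply: game_pebble => //.
by apply: IH => //; lia.
Qed.

Lemma game_trans s w e w' e' w'' e'' :
  game s w e w' e' -> game s w' e' w'' e'' -> game s w e w'' e''.
Proof.
elim: s e e' e'' => [|b s IH] e e' e'' /=.
  case=> val1 ord1 [val2 ord2]; split=> [x|x y i j i'' j'' ei ej ei'' ej''].
    case: (e x) (e' x) (e'' x) (val1 x) (val2 x) => [i|] [i'|] [i''|] //.
    by case=> lt_i lt_i' -> [_ lt_i'' ->].
  have [i' ei'] : exists i', e' x = Some i'.
    by have := val1 x; rewrite ei; case: (e' x) => // i' _; exists i'.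
  have [j' ej'] : exists j', e' y = Some j'.
    by have := val1 y; rewrite ej; case: (e' y) => // j' _; exists j'.
  by rewrite (ord1 _ _ _ _ _ _ ei ej ei' ej'); apply: (ord2 x y).
case=> none1 move1 [none2 move2]; split; first exact: IH none1 none2.
case: b move1 move2 => move1 move2 i lt_i.
  have [i' /move2[i'' lt_i'' game2] game1] := move1 i lt_i.
  by exists i'' => //; apply: IH game1 game2.
have [i' /move1[i'' lt_i'' game1] game2] := move2 i lt_i.
by exists i'' => //; apply: IH game1 game2.
Qed.

(** Emptiness is compared separately because a sentence and its prenex form need agree only on
    nonempty words. *)
Definition word_le s w w' := (w == [::]) = (w' == [::]) /\ game s w env0 w' env0.

Lemma word_le_refl s w : word_le s w w.
Proof. by split=> //; apply: game_refl. Qed.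

Lemma word_le_cat s u u' v v' :
  word_le s u u' -> word_le s v v' -> word_le s (u ++ v) (u' ++ v').
Proof.
case=> eu gu [ev gv]; split; last exact: game_cat0.
by rewrite -!size_eq0 !size_cat !addn_eq0 !size_eq0 eu ev.
Qed.

Lemma word_le_trans s w w' w'' :
  word_le s w w' -> word_le s w' w'' -> word_le s w w''.
Proof.
by case=> e1 g1 [e2 g2]; split; [rewrite e1|apply: game_trans g1 g2].
Qed.

Lemma word_le_pump n m u v : {subset v <= u} -> let p := (pump_bound n m).+1 in
  word_le (nseq n true ++ nseq m false) (wpow u p) (wpow u p ++ v ++ wpow u p).
Proof.
move=> sub_vu p; split; last by apply: game_pump.
have empty_pow k : (wpow u k.+1 == [::]) = (u == [::]).
  rewrite -!size_eq0 size_wpowS addn_eq0; case: eqP => // /size0nil ->.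
  by rewrite /wpow; elim: k.
have cat_empty (x y : seq A) : (x ++ y == [::]) = (x == [::]) && (y == [::]) by case: x.
rewrite {}/p (cat_empty (wpow _ _)) (cat_empty v) !empty_pow.
case: eqP => //= u0; case: v sub_vu => // a v /(_ a).
by rewrite u0 mem_head => /(_ isT).
Qed.

End Games.

(** * Sigma_2 sentences are preserved along the game *)

Section Preservation.

Variable A : finType.
Implicit Types (f g : formula A) (w : seq A).

Lemma sat_ext w e e' f : e =1 e' -> sat w e f = sat w e' f.
Proof. by move=> /functional_extensionality ->. Qed.

Lemma sat_rename w r e f : sat w e (rename r f) = sat w (e \o r) f.
Proof.
elim: f r e => [a x|x y|x y|g IH|c g IHg h IHh|q g IH] r e //=.
- by rewrite IH.
- by rewrite IHg IHh.
have ext i : scons i e \o scons 0 (succn \o r) =1 scons i (e \o r) by case.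
by case: q; [apply: eq_existsb|apply: eq_forallb] => i; rewrite IH (sat_ext _ _ (ext i)).
Qed.

Lemma sat_shift w i e f : sat w (scons i e) (shift f) = sat w e f.
Proof. by rewrite /shift sat_rename. Qed.

Definition quant_sat q n (P : pred 'I_n) :=
  if q is Ex then [exists i, P i] else [forall i, P i].
Definition conn_sat c b b' := if c is And then b && b' else b || b'.

Lemma sat_quant w e q f :
  sat w e (Quant q f) = quant_sat q (fun i : 'I_(size w) => sat w (scons (val i) e) f).
Proof. by case: q. Qed.

Lemma sat_conn w e c f g : sat w e (Conn c f g) = conn_sat c (sat w e f) (sat w e g).
Proof. by case: c. Qed.

Lemma eq_quant_sat q n (P P' : pred 'I_n) : P =1 P' -> quant_sat q P = quant_sat q P'.
Proof. by case: q => eqP; [apply: eq_existsb|apply: eq_forallb]. Qed.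

Lemma quant_sat_const q n b : 0 < n -> quant_sat q (fun _ : 'I_n => b) = b.
Proof.
move=> n_gt0; pose i := Ordinal n_gt0.
case: q => /=; first by apply/existsP/idP => [[]|] //; exists i.
by apply/forallP/idP => [/(_ i)|].
Qed.

Lemma conn_quant_sat c q n (P : pred 'I_n) b : 0 < n ->
  conn_sat c (quant_sat q P) b = quant_sat q (fun i => conn_sat c (P i) b).
Proof.
move=> n_gt0; case: c b => -[] /=.
- by rewrite andbT; apply: eq_quant_sat => i; rewrite andbT.
- rewrite andbF -[LHS](@quant_sat_const q n) //.
  by apply: eq_quant_sat => i; rewrite andbF.
- rewrite orbT -[LHS](@quant_sat_const q n) //.
  by apply: eq_quant_sat => i; rewrite orbT.
- by rewrite orbF; apply: eq_quant_sat => i; rewrite orbF.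
Qed.

Lemma conn_satC c b b' : conn_sat c b b' = conn_sat c b' b.
Proof. by case: c; case: b; case: b'. Qed.

Lemma prenex_step_sat f g w : 0 < size w -> prenex_step f g ->
  forall e, sat w e f = sat w e g.
Proof.
move=> w_gt0; elim=> {f g} [q f|c q f g|c q f g|f f' _ IH|c f f' g _ IH|c f g g' _ IH
  |q f f' _ IH] e.
- by case: q; rewrite /= ?negb_exists ?negb_forall.
- rewrite sat_conn !sat_quant conn_quant_sat //.
  by apply: eq_quant_sat => i; rewrite sat_conn sat_shift.
- rewrite sat_conn !sat_quant conn_satC conn_quant_sat //.
  by apply: eq_quant_sat => i; rewrite sat_conn sat_shift conn_satC.
- by rewrite /= IH.
- by rewrite !sat_conn IH.
- by rewrite !sat_conn IH.
- by rewrite !sat_quant; apply: eq_quant_sat => i; apply: IH.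
Qed.

Lemma prenex_steps_sat f g w e : 0 < size w -> prenex_steps f g ->
  sat w e f = sat w e g.
Proof.
by move=> w_gt0; elim=> // f1 f2 f3 st _ <-; apply: prenex_step_sat st e.
Qed.

Lemma closed_rename n m r f : (forall x, x < n -> r x < m) ->
  Defs.closed n f -> Defs.closed m (rename r f).
Proof.
elim: f n m r => [a x|x y|x y|g IH|c g IHg h IHh|q g IH] n m r lt_r /=.
- exact: lt_r.
- by case/andP=> /lt_r -> /lt_r.
- by case/andP=> /lt_r -> /lt_r.
- exact: IH.
- by case/andP=> /(IHg _ _ _ lt_r) -> /(IHh _ _ _ lt_r).
- by apply: IH => -[|x] //; rewrite ltnS => /lt_r.
Qed.

Lemma closed_shift n f : Defs.closed n f -> Defs.closed n.+1 (shift f).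
Proof. exact: closed_rename. Qed.

Lemma prenex_steps_closed f g n : prenex_steps f g -> Defs.closed n f -> Defs.closed n g.
Proof.
move=> st; elim: st n => // f1 f2 f3 {f g} st _ IH n cl; apply: IH.
elim: st n cl => {f1 f2 f3} [q f|c q f g|c q f g|f f' _ IH|c f f' g _ IH|c f g g' _ IH
  |q f f' _ IH] n //=.
- by case/andP=> -> /closed_shift.
- by case/andP=> /closed_shift ->.
- exact: IH.
- by case/andP=> /IH ->.
- by case/andP=> -> /IH.
- exact: IH.
Qed.

Lemma agree_sat w E w' E' e e' n f :
  agree w e w' e' -> quantifier_free f -> Defs.closed n f ->
  (forall x, x < n -> e x = Some (E x) /\ e' x = Some (E' x)) ->
  sat w E f = sat w' E' f.
Proof.
case=> letters order + + defE.
elim: f => [a x|x y|x y|g IH|c g IHg h IHh|//] //=.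
- move=> _ /defE[ex ex']; have := letters x; rewrite ex ex'.
  by case=> _ _ ->.
- move=> _ /andP[/defE[ex ex'] /defE[ey ey']].
  by rewrite (order x y _ _ _ _ ex ey ex' ey').
- move=> _ /andP[/defE[ex ex'] /defE[ey ey']].
  rewrite !eqn_leq ![E _ <= _]leqNgt ![E' _ <= _]leqNgt.
  by rewrite (order x y _ _ _ _ ex ey ex' ey') (order y x _ _ _ _ ey ex ey' ex').
- by move=> qf cl; rewrite IH.
- by case: c => /andP[qg qh] /andP[cg ch]; rewrite IHg ?IHh.
Qed.

Lemma game_sat w E w' E' e e' n f :
  game (prefix_of f) w e w' e' -> prenex f -> Defs.closed n f ->
  (forall x, x < n -> e x = Some (E x) /\ e' x = Some (E' x)) ->
  sat w E f -> sat w' E' f.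
Proof.
have defS n' (E1 E1' : nat -> nat) (e1 e1' : nat -> option nat) i i' :
    (forall x, x < n' -> e1 x = Some (E1 x) /\ e1' x = Some (E1' x)) ->
    forall x, x < n'.+1 -> scons (Some i) e1 x = Some (scons i E1 x) /\
      scons (Some i') e1' x = Some (scons i' E1' x).
  by move=> def [|x] //; apply: def.
elim: f n E E' e e' => [a x|x y|x y|g _|c g _ h _|q g IH] n E E' e e'.
1-5: by move=> agr qf cl defE; rewrite (agree_sat agr qf cl defE).
rewrite [prefix_of _]/= [prenex _]/= [Defs.closed _ _]/= !sat_quant => -[_].
case: q => move_q pre cl defE /=.
  case/existsP=> i sat_i; have [i' lt_i' game_i] := move_q (val i) (ltn_ord i).
  apply/existsP; exists (Ordinal lt_i'); move: sat_i.
  exact: (IH _ _ _ _ _ game_i pre cl (defS _ _ _ _ _ _ _ defE)).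
move/forallP=> sat_all; apply/forallP=> i'.
have [i lt_i game_i] := move_q (val i') (ltn_ord i').
move: (sat_all (Ordinal lt_i)).
exact: (IH _ _ _ _ _ game_i pre cl (defS _ _ _ _ _ _ _ defE)).
Qed.

Lemma prefix_Sigma2 (s : bitseq) :
  (nblocks s = 2 /\ head true s = true) \/ nblocks s < 2 ->
  exists n m, s = nseq n true ++ nseq m false.
Proof.
have blocks_gt0 b t : 0 < nblocks (b :: t).
  elim: t b => [|c t IH] b; first by case: b.
  by rewrite [nblocks _]/= -/(nblocks (c :: t)) (leq_trans (IH c)) ?leq_addl.
have one_block b t : nblocks (b :: t) < 2 -> t = nseq (size t) b.
  elim: t b => [|c t IH] b //; rewrite [nblocks _]/= -/(nblocks (c :: t)).
  case: eqP => [->|_]; first by rewrite add0n => /IH {1}->.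
  by have := blocks_gt0 c t; lia.
elim: s => [|b s IH] blocks; first by exists 0, 0.
case: b blocks => blocks; last first.
  case: blocks => [[_ //]|/one_block ->]; by exists 0, (size s).+1.
have [|n [m ->]] := IH; last by exists n.+1, m.
case: s blocks {IH} => [|c s]; first by right.
rewrite ![nblocks (true :: _)]/= -/(nblocks (c :: s)).
by case: c => /= blocks; [lia|right; case: blocks; lia].
Qed.

(** On nonempty words the sentence has the truth value of its prenex form, to which the game
    applies; the empty word is related only to itself. *)
Lemma Sigma2_word_le (K : language A) : Sigma 2 K ->
  exists n m, forall w w', word_le (nseq n true ++ nseq m false) w w' -> K w -> K w'.
Proof.
case=> f [cl [g [st pre blocks]] defK].
have [n [m def_s]] := prefix_Sigma2 blocks.
exists n, m => w w' [empty_w game_w]; rewrite !defK /models.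
have [w0|w_gt0] := posnP (size w).
  by rewrite (size0nil w0) eqxx in empty_w *; move/esym/eqP: empty_w => ->.
have w'_gt0 : 0 < size w' by move: w_gt0; rewrite !lt0n !size_eq0 empty_w.
rewrite !(prenex_steps_sat _ _ st) //; rewrite -def_s in game_w.
exact: (game_sat game_w pre (prenex_steps_closed st cl)).
Qed.

End Preservation.

(** * Separability yields a saturated safe set *)

Lemma set_of_prop (T : finType) (P : T -> Prop) : exists J : {set T}, forall x, x \in J <-> P x.
Proof.
exists [set x | if excluded_middle_informative (P x) then true else false] => x.
by rewrite inE; case: excluded_middle_informative.
Qed.

Section Soundness.

Variables (A : finType) (M1 M2 : nfa A) (n m : nat).
Local Notation s := (nseq n true ++ nseq m false).
Local Notation wtype := (wtype M1 M2).

Definition realizes (x : wtype) w := [/\ alph w = x.1.1, rel_word M1 w = x.1.2 &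
  forall p q, (p, q) \in x.2 -> exists2 w', word_le s w w' & (p, q) \in rel_word M2 w'].

Lemma realizes_mul x y u v :
  realizes x u -> realizes y v -> realizes (wtype_mul x y) (u ++ v).
Proof.
case=> alph_u rel_u le_u [alph_v rel_v le_v].
split; rewrite /= ?alph_cat ?rel_word_cat ?alph_u ?alph_v ?rel_u ?rel_v //.
move=> p q /rel_compP[r /le_u[u' le_u' pr] /le_v[v' le_v' rq]].
exists (u' ++ v'); first exact: word_le_cat.
by rewrite rel_word_cat; apply/rel_compP; exists r.
Qed.

Lemma realizes_power e w k :
  wtype_mul e e = e -> realizes e w -> realizes e (wpow w k.+1).
Proof.
move=> ee real_w; elim: k => [|k IH]; first by rewrite /wpow /= cats0.
by rewrite -ee -[wpow w _]/(w ++ wpow w k.+1); apply: realizes_mul.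
Qed.

(* The words [u1] and [u2] above the power of [w] are read on both sides of a
   word [v] over the letters of [w], which the power absorbs. *)
Lemma realizes_pump e w : wtype_mul e e = e -> realizes e w ->
  realizes (wtype_pump e) (wpow w (pump_bound n m).+1).
Proof.
move=> ee real_w; set k := pump_bound n m.
have [alph_wk rel_wk le_wk] := realizes_power k ee real_w.
split=> // p q /rel_compP[q'].
case/rel_compP=> p' /le_wk[u1 le_u1 pp'] /rel_starP[v sub_v p'q'] /le_wk[u2 le_u2 q'q].
exists (u1 ++ v ++ u2); last first.
  rewrite !rel_word_cat; apply/rel_compP; exists p' => //.
  by apply/rel_compP; exists q'.
have sub_vw : {subset v <= w}.
  move=> a av; have := allP sub_v a av; rewrite -[mem _ a]/(a \in e.1.1).
  by case: real_w => <- _ _; rewrite inE.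
apply: word_le_trans (word_le_pump n m sub_vw) _.
by apply: word_le_cat => //; apply: word_le_cat => //; apply: word_le_refl.
Qed.

(** The set is that of all realized types. A bad realized type would give a word of the first
    language below a word of the second one, and [K], being closed upwards, would contain both. *)
Lemma separable_saturated (K : language A) :
  (forall w w', word_le s w w' -> K w -> K w') ->
  (forall w, recognized M1 w -> K w) -> (forall w, ~ (K w /\ recognized M2 w)) ->
  exists J : {set wtype}, saturated J /\ safe J.
Proof.
move=> up_K sub_K dis_K.
have [J defJ] := set_of_prop (fun x : wtype => exists w, realizes x w).
exists J; split; first split.
- apply/defJ; exists [::]; split=> //=.
  by move=> p q pq; exists [::] => //; apply: word_le_refl.
- move=> a; apply/defJ; exists [:: a]; split; rewrite ?rel_word1 //.
    by apply/setP=> b; rewrite !inE.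
  by move=> p q pq; exists [:: a]; rewrite ?rel_word1 //; apply: word_le_refl.
- move=> x y /defJ[u real_u] /defJ[v real_v]; apply/defJ.
  by exists (u ++ v); apply: realizes_mul.
- by move=> e /defJ[w real_w] ee; apply/defJ; eexists; apply: realizes_pump ee real_w.
move=> x /defJ[w [_ rel_w le_w]]; rewrite -rel_w => /recognized_meets/sub_K Kw.
case/exists_inP=> p ini_p /exists_inP[q fin_q /le_w[w' le_w' pq]].
by apply: (dis_K w'); split; [apply: up_K le_w' Kw|apply/recognizedP; exists p, q].
Qed.

End Soundness.
(** * Sigma_2 sentences from monomials *)

Section PrenexForms.

Variable A : finType.
Implicit Types (f g h : formula A) (w : seq A).

Definition sigma2_prefix n m f :=
  prenex f /\ prefix_of f = nseq n true ++ nseq m false.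

Definition sigma2_form f := exists n m g, prenex_steps f g /\ sigma2_prefix n m g.

Lemma prenex_steps_trans f g h : prenex_steps f g -> prenex_steps g h -> prenex_steps f h.
Proof. by elim=> // f1 f2 f3 st _ IH /IH; apply: prenex_trans. Qed.

Lemma prenex_steps_left c f f' g :
  prenex_steps f f' -> prenex_steps (Conn c f g) (Conn c f' g).
Proof.
elim=> [f1|f1 f2 f3 st _]; first exact: prenex_refl.
by apply: prenex_trans; apply: step_left.
Qed.

Lemma prenex_steps_right c f g g' :
  prenex_steps g g' -> prenex_steps (Conn c f g) (Conn c f g').
Proof.
elim=> [f1|f1 f2 f3 st _]; first exact: prenex_refl.
by apply: prenex_trans; apply: step_right.
Qed.

Lemma prenex_steps_quant q f f' :
  prenex_steps f f' -> prenex_steps (Quant q f) (Quant q f').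
Proof.
elim=> [f1|f1 f2 f3 st _]; first exact: prenex_refl.
by apply: prenex_trans; apply: step_quant.
Qed.

Lemma prefix_rename r f : prefix_of (rename r f) = prefix_of f.
Proof. by elim: f r => //= q g IH r; rewrite IH. Qed.

Lemma quantifier_free_rename r f : quantifier_free (rename r f) = quantifier_free f.
Proof. by elim: f r => //= c g IHg h IHh r; rewrite IHg IHh. Qed.

Lemma prenex_rename r f : prenex (rename r f) = prenex f.
Proof.
elim: f r => [a x|x y|x y|g _|c g _ h _|q g IH] r //=; first exact: quantifier_free_rename.
by rewrite !quantifier_free_rename.
Qed.

Lemma sigma2_prefix_shift n m f : sigma2_prefix n m f -> sigma2_prefix n m (shift f).
Proof. by case=> pre def_f; split; rewrite ?prenex_rename ?prefix_rename. Qed.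

Lemma sigma2_prefixS n m f : sigma2_prefix n.+1 m f ->
  exists2 g, f = Quant Ex g & sigma2_prefix n m g.
Proof. by case; case: f => //= -[] g pre // [def_g]; exists g. Qed.

Lemma sigma2_prefix0S m f : sigma2_prefix 0 m.+1 f ->
  exists2 g, f = Quant All g & sigma2_prefix 0 m g.
Proof. by case; case: f => //= -[] g pre // [def_g]; exists g. Qed.

Lemma sigma2_prefix00 f : sigma2_prefix 0 0 f -> quantifier_free f.
Proof. by case; case: f. Qed.

Lemma sigma2_prefix_ex n m f : sigma2_prefix n m f -> sigma2_prefix n.+1 m (Quant Ex f).
Proof. by case=> pre def_f; split=> //=; rewrite def_f. Qed.

Lemma sigma2_prefix_all m f : sigma2_prefix 0 m f -> sigma2_prefix 0 m.+1 (Quant All f).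
Proof. by case=> pre def_f; split=> //=; rewrite def_f. Qed.

Lemma sigma2_pull c q f g f' g' h :
  prenex_step (Conn c f g) (Quant q (Conn c f' g')) ->
  prenex_steps (Conn c f' g') h -> prenex_steps (Conn c f g) (Quant q h).
Proof. by move=> st /(prenex_steps_quant q); apply: prenex_trans. Qed.

(** The existential quantifiers of both sides are pulled out before any universal one, so the result
    is again one existential block followed by one universal block. *)
Lemma sigma2_conn_prefix c n m n' m' f g :
  sigma2_prefix n m f -> sigma2_prefix n' m' g -> sigma2_form (Conn c f g).
Proof.
elim: n f g => [|n IHn] f g; last first.
  case/sigma2_prefixS=> f' -> pf /sigma2_prefix_shift pg.
  have [k [l [h [st ph]]]] := IHn _ _ pf pg; exists k.+1, l, (Quant Ex h).
  by split; [apply: sigma2_pull st; apply: pull_left|apply: sigma2_prefix_ex].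
elim: n' f g => [|n' IHn'] f g; last first.
  move=> /sigma2_prefix_shift pf /sigma2_prefixS[g' -> pg].
  have [k [l [h [st ph]]]] := IHn' _ _ pf pg; exists k.+1, l, (Quant Ex h).
  by split; [apply: sigma2_pull st; apply: pull_right|apply: sigma2_prefix_ex].
move=> pf pg; exists 0.
elim: m f g pf pg => [|m IHm] f g; last first.
  case/sigma2_prefix0S=> f' -> pf /sigma2_prefix_shift pg.
  have [l [h [st ph]]] := IHm _ _ pf pg; exists l.+1, (Quant All h).
  by split; [apply: sigma2_pull st; apply: pull_left|apply: sigma2_prefix_all].
elim: m' f g => [|m' IHm'] f g; last first.
  move=> /sigma2_prefix_shift pf /sigma2_prefix0S[g' -> pg].
  have [l [h [st ph]]] := IHm' _ _ pf pg; exists l.+1, (Quant All h).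
  by split; [apply: sigma2_pull st; apply: pull_right|apply: sigma2_prefix_all].
move=> /sigma2_prefix00 qf /sigma2_prefix00 qg; exists 0, (Conn c f g).
by split; [apply: prenex_refl|split=> //=; rewrite qf].
Qed.

Lemma sigma2_conn c f g : sigma2_form f -> sigma2_form g -> sigma2_form (Conn c f g).
Proof.
case=> [n [m [f' [st_f pf]]]] [n' [m' [g' [st_g pg]]]].
have [k [l [h [st ph]]]] := sigma2_conn_prefix c pf pg; exists k, l, h; split=> //.
apply: prenex_steps_trans st; apply: prenex_steps_trans (prenex_steps_right _ _ st_g).
exact: prenex_steps_left.
Qed.

Lemma sigma2_ex f : sigma2_form f -> sigma2_form (Quant Ex f).
Proof.
case=> [n [m [g [st pg]]]]; exists n.+1, m, (Quant Ex g).
by split; [apply: prenex_steps_quant|apply: sigma2_prefix_ex].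
Qed.

Lemma sigma2_qf f : quantifier_free f -> sigma2_form f.
Proof.
move=> qf; exists 0, 0, f; split; first exact: prenex_refl.
by split; case: f qf.
Qed.

Lemma sigma2_all f : quantifier_free f -> sigma2_form (Quant All f).
Proof.
move=> qf; exists 0, 1, (Quant All f); split; first exact: prenex_refl.
by apply: sigma2_prefix_all; split; case: f qf.
Qed.

Lemma alternation_sigma2 f : sigma2_form f -> alternation true 2 f.
Proof.
case=> [n [m [g [st [pre def_g]]]]]; exists g; split=> //; rewrite def_g.
have blocks b k : nblocks (nseq k.+1 b) = 1.
  by elim: k => [|k IH]; [case: b|rewrite -[LHS]/((b != b) + _) eqxx].
case: n m {def_g} => [|n] [|m]; [by right|by right; rewrite blocks| |].
  by right; rewrite cats0 blocks.
left; split=> //; elim: n => [|n IH]; last exact: IH.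
by rewrite -[LHS]/(1 + nblocks (nseq m.+1 false)) blocks.
Qed.

End PrenexForms.

(** * Monomials and their defining sentences *)

Section Monomials.

Variable A : finType.
Local Notation item := (A + {set A})%type.
Implicit Types (K : seq item) (w : seq A) (e : nat -> nat).

(* A monomial is a product of letters [inl a] and of languages [inr B] = [B*]. *)
Fixpoint mono K w : Prop :=
  match K with
  | [::] => w = [::]
  | inl a :: K' => exists2 v, w = a :: v & mono K' v
  | inr B :: K' => exists u v, [/\ w = u ++ v, all (mem B) u & mono K' v]
  end.

Lemma mono_cat K K' u v : mono K u -> mono K' v -> mono (K ++ K') (u ++ v).
Proof.
elim: K u => [|[a|B] K IH] u /=; first by move=> -> .
  by case=> u' -> Ku' K'v; exists (u' ++ v) => //; apply: IH.
by case=> x [y [-> Bx Ky]] K'v; exists x, (y ++ v); rewrite catA; split=> //; apply: IH.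
Qed.

(* The left end of the suffix under consideration: just after the variable
   [x], or the beginning of the word. *)
Definition start e (o : option nat) := if o is Some x then (e x).+1 else 0.
Definition after (o : option nat) y : formula A :=
  if o is Some x then Less x y else Equal y y.
Definition letter_in (B : {set A}) y : formula A :=
  foldr (fun a f => Conn Or (Letter a y) f) (Less y y) (enum B).

(** The existential variable marks the position of a letter, or the last position of a nonempty
    block; an empty block has none, hence the first disjunct. The maps on [o] carry the left end
    under one or two new binders. *)
Fixpoint mono_formula K o : formula A :=
  match K with
  | [::] => Quant All (Not (after (omap succn o) 0))
  | inl a :: K' =>
      Quant Ex (Conn And (Conn And (after (omap succn o) 0) (Letter a 0))
        (Conn And (Quant All (Not (Conn And (after (omap (addn 2) o) 0) (Less 0 1))))
                  (mono_formula K' (Some 0))))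
  | inr B :: K' =>
      Conn Or (mono_formula K' o)
        (Quant Ex (Conn And (after (omap succn o) 0)
          (Conn And (Quant All (Conn Or
                       (Not (Conn And (after (omap (addn 2) o) 0) (Not (Less 1 0))))
                       (letter_in B 0)))
                    (mono_formula K' (Some 0)))))
  end.

Lemma sat_after w e o y : sat w e (after o y) = (start e o <= e y).
Proof. by case: o => [x|] //=; rewrite eqxx. Qed.

Lemma start_succ e i o : start (scons i e) (omap succn o) = start e o.
Proof. by case: o. Qed.

Lemma start_succ2 e i j o : start (scons i (scons j e)) (omap (addn 2) o) = start e o.
Proof. by case: o. Qed.

Lemma sat_letter_in w e B y :
  sat w e (letter_in B y) <-> exists2 a, a \in B & onth w (e y) = Some a.
Proof.
have satE (s : seq A) : sat w e (foldr (fun a f => Conn Or (Letter a y) f) (Less y y) s)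
    <-> exists2 a, a \in s & onth w (e y) = Some a.
  elim: s => [|b s IH] /=; first by rewrite ltnn; split=> // -[].
  split=> [/orP[/eqP eq_b|/IH[a sa eq_a]]|[a]]; first by exists b; rewrite ?mem_head.
    by exists a; rewrite // inE sa orbT.
  rewrite inE => /orP[/eqP -> ->|sa eq_a]; first by rewrite eqxx.
  by apply/orP; right; apply/IH; exists a.
rewrite satE; split=> -[a Ba eq_a]; exists a => //; first by rewrite -mem_enum.
by rewrite mem_enum.
Qed.

Lemma drop_onth w i a : onth w i = Some a -> drop i w = a :: drop i.+1 w.
Proof.
move=> wi; have lt_i : i < size w by rewrite -onthTE wi.
by rewrite (drop_nth a lt_i) (@onth_nth _ a a w i wi).
Qed.

Lemma onth_size w i a : onth w i = Some a -> i < size w.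
Proof. by move=> wi; rewrite -onthTE wi. Qed.

Lemma onth_drop w k i : onth (drop k w) i = onth w (k + i).
Proof. by rewrite !onthE map_drop nth_drop. Qed.

Lemma onth_lt w i : i < size w -> exists a, onth w i = Some a.
Proof. by rewrite -onthTE; case: onth => // a _; exists a. Qed.

Lemma sat_mono w K e o :
  sat w e (mono_formula K o) <-> mono K (drop (start e o) w).
Proof.
elim: K e o => [|[a|B] K IH] e o /=.
- split=> [/forallP none|/(congr1 size)]; last first.
    rewrite size_drop => /eqP; rewrite subn_eq0 => le_w; apply/forallP=> i.
    rewrite sat_after start_succ /= -ltnNge; exact: leq_trans (ltn_ord i) le_w.
  apply/drop_oversize; rewrite leqNgt; apply/negP=> lt_w.
  by have := none (Ordinal lt_w); rewrite sat_after start_succ /= leqnn.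
- split.
    case/existsP=> i /and3P[/andP[le_i /eqP wi] /forallP none /IH Kw].
    rewrite sat_after start_succ /= in le_i.
    have eq_i : start e o = i.
      apply/eqP; rewrite eqn_leq le_i leqNgt; apply/negP=> lt_i.
      have := none (Ordinal (ltn_trans lt_i (ltn_ord i))).
      by rewrite sat_after start_succ2 /= leqnn lt_i.
    by rewrite eq_i (drop_onth wi); exists (drop i.+1 w).
  case=> v def_v Kv.
  have wi : onth w (start e o) = Some a by rewrite -[start e o]addn0 -onth_drop def_v.
  have def_v' : drop (start e o).+1 w = v by move: (drop_onth wi); rewrite def_v => -[].
  apply/existsP; exists (Ordinal (onth_size wi)); rewrite sat_after start_succ /= leqnn.
  rewrite wi eqxx !andTb; apply/andP; split; last by apply/IH; rewrite /= def_v'.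
  apply/forallP=> y; rewrite sat_after start_succ2 /=; lia.
split.
  case/orP=> [/IH Kw|]; first by exists [::], (drop (start e o) w).
  case/existsP=> i /and3P[le_i /forallP letters /IH Kw].
  rewrite sat_after start_succ /= in le_i.
  (* The block runs from the left end through position [i] included. *)
  exists (take (i.+1 - start e o) (drop (start e o) w)), (drop i.+1 w).
  split=> //; first by rewrite -{1}(cat_take_drop (i.+1 - start e o) (drop _ _))
    drop_drop subnK // ltnW.
  apply/allP=> a /onthP[k]; rewrite take_drop onth_drop subnK; last exact: ltnW.
  move=> wk; have := onth_size wk; rewrite size_takel // => lt_ki.
  have lt_kw : start e o + k < size w by have := ltn_ord i; lia.
  have {}wk : onth w (start e o + k) = Some a.
    by rewrite -wk -{1}(cat_take_drop i.+1 w) onth_cat size_takel ?lt_ki.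
  have := letters (Ordinal lt_kw); rewrite sat_after start_succ2 /=.
  case/orP; first by rewrite negb_and negbK; lia.
  by case/sat_letter_in=> b Bb /=; rewrite wk => -[->].
case=> u [v [def_w Bu Kv]]; apply/orP.
case: u def_w Bu => [def_w _|a u def_w Bu]; first by left; apply/IH; rewrite def_w.
right.
have le_w : start e o + size (a :: u) <= size w.
  by have := congr1 size def_w; rewrite size_drop size_cat /=; lia.
(* The block [a :: u] has one letter more than [u], so its last position is [start e o + size u]. *)
apply/existsP; have lt_w : start e o + size u < size w by rewrite /= in le_w; lia.
exists (Ordinal lt_w); rewrite sat_after start_succ /= leq_addr /=.
apply/andP; split; last first.
  apply/IH; rewrite /= -addnS addnC -drop_drop def_w.
  by rewrite drop_size_cat.
apply/forallP=> y; apply/orP; rewrite sat_after start_succ2 /= negb_and negbK.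
have [lt_y|le_y] := ltnP y (start e o); first by left.
have [gt_y|le_y'] := ltnP (start e o + size u) y; first by left.
right; apply/sat_letter_in; have [b wy] := onth_lt (ltn_ord y); exists b => //=.
apply: (allP Bu); apply/onthP; exists (y - start e o).
have : onth (drop (start e o) w) (y - start e o) = Some b by rewrite onth_drop subnKC.
by rewrite def_w onth_cat /= ltnS leq_subLR le_y'.
Qed.

Lemma qf_after o y : quantifier_free (after o y).
Proof. by case: o. Qed.

Lemma qf_letter_in B y : quantifier_free (letter_in B y).
Proof. by rewrite /letter_in; elim: (enum B). Qed.

Lemma sigma2_mono K o : sigma2_form (mono_formula K o).
Proof.
elim: K o => [|[a|B] K IH] o /=.
- by apply: sigma2_all; rewrite /= qf_after.
- apply: sigma2_ex; apply: sigma2_conn; first by apply: sigma2_qf; rewrite /= qf_after.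
  by apply: sigma2_conn => //; apply: sigma2_all; rewrite /= qf_after.
apply: sigma2_conn => //; apply: sigma2_ex; apply: sigma2_conn.
  by apply: sigma2_qf; rewrite qf_after.
by apply: sigma2_conn => //; apply: sigma2_all; rewrite /= qf_after qf_letter_in.
Qed.

Lemma closed_after n o y : y < n -> (if o is Some x then x < n else true) ->
  Defs.closed n (after o y).
Proof. by move=> lt_y; case: o => [x /= ->|_ /=]; rewrite lt_y. Qed.

Lemma closed_letter_in n B y : y < n -> Defs.closed n (letter_in B y).
Proof. by move=> lt_y; rewrite /letter_in; elim: (enum B) => /= [|a s ->]; rewrite lt_y. Qed.

Lemma closed_mono K n o : (if o is Some x then x < n else true) ->
  Defs.closed n (mono_formula K o).
Proof.
elim: K n o => [|[a|B] K IH] n o lt_o /=.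
- by apply: closed_after => //; case: o lt_o.
- by rewrite !closed_after ?IH //; case: o lt_o.
by rewrite IH // !closed_after ?closed_letter_in ?IH //; case: o lt_o.
Qed.

Lemma Sigma2_union (Ks : seq (seq item)) :
  Sigma 2 (fun w => exists2 K, K \in Ks & mono K w).
Proof.
(* [Less 0 0] is false, and the quantifier in front of it makes the empty disjunction a sentence. *)
exists (foldr (fun K f => Conn Or (mono_formula K None) f)
  (Quant Ex (Less 0 0)) Ks); split.
- by rewrite /sentence; elim: Ks => //= K Ks ->; rewrite closed_mono.
- apply: alternation_sigma2; elim: Ks => [|K Ks IH] /=.
    by apply: sigma2_ex; apply: sigma2_qf.
  exact: sigma2_conn (sigma2_mono _ _) IH.
move=> w; rewrite /models; elim: Ks => [|K Ks IH] /=.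
  by split=> [[]//|/existsP[i]]; rewrite ltnn.
have satK := sat_mono w K (fun=> 0) None; rewrite drop0 in satK.
split=> [[K']|/orP[/satK Kw|/IH[K' Ks' K'w]]].
- by rewrite inE => /orP[/eqP -> /satK -> //|Ks' K'w]; apply/orP; right; apply/IH; exists K'.
- by exists K; rewrite ?mem_head.
by exists K'; rewrite // inE Ks' orbT.
Qed.

End Monomials.

(** * A saturated safe set yields a separator *)

Section Completeness.

Variables (A : finType) (M1 M2 : nfa A).
Local Notation item := (A + {set A})%type.
Local Notation wtype := (wtype M1 M2).

Definition imprint_item (i : item) : {set state M2 * state M2} :=
  match i with inl a => rel_letter M2 a | inr B => rel_star M2 B end.
(** The union of the relations in [M2] of all words in the monomial. *)
Definition imprint (K : seq item) :=
  foldr (fun i S => rel_comp (imprint_item i) S) (rel_id M2) K.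

Lemma imprint_cat K K' : imprint (K ++ K') = rel_comp (imprint K) (imprint K').
Proof. by elim: K => [|i K IH] /=; rewrite ?rel_comp1 // IH rel_compA. Qed.

Lemma mono_imprint K w : mono K w -> rel_word M2 w \subset imprint K.
Proof.
elim: K w => [|[a|B] K IH] w /=; first by move=> ->.
  by case=> v -> /IH; apply: rel_compS.
case=> u [v [-> Bu /IH subK]]; rewrite rel_word_cat; apply: rel_compS => //.
by apply/subsetP=> -[p q] pq; apply/rel_starP; exists u.
Qed.

(** The evaluation relation given to [bounded_factorization]. Letters and relation in [M1] are
    exact, while the last component only bounds the imprint of a monomial around [w]; the cost is
    the length of that monomial. *)
Definition covers (J : {set wtype}) n w (x : wtype) :=
  [/\ x \in J, x.1 = (alph w, rel_word M1 w) &
      exists K, [/\ size K <= n, mono K w & imprint K \subset x.2]].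

(** The first and the last word keep their monomials, and everything between is a word over the
    letters of [e], covered by one starred item; the length is at most [n + 1 + n]. *)
Lemma covers_pump J n e us : saturated J -> wtype_mul e e = e -> 1 < size us ->
  (forall u, u \in us -> covers J n u e) ->
  covers J n.*2.+1 (flatten us) (wtype_pump e).
Proof.
move=> [_ _ _ pumpJ] ee size_us cov.
have flat_type vs : 0 < size vs -> {subset vs <= us} ->
    (alph (flatten vs), rel_word M1 (flatten vs)) = e.1.
  elim: vs => // v [|v' vs] IH _ sub; have [_ def_v _] := cov v (sub v (mem_head _ _)).
    by rewrite /= cats0 -def_v.
  rewrite -[flatten _]/(v ++ flatten (v' :: vs)) alph_cat rel_word_cat.
  have IHv : (alph (flatten (v' :: vs)), rel_word M1 (flatten (v' :: vs))) = e.1.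
    by apply: IH => // u vu; apply: sub; rewrite inE vu orbT.
  have [def_a def_r] := (congr1 fst IHv, congr1 snd IHv); rewrite /= in def_a def_r.
  have [def_a' def_r'] := (congr1 fst def_v, congr1 snd def_v); rewrite /= in def_a' def_r'.
  rewrite -[flatten (v' :: vs)]/(v' ++ flatten vs) in def_a def_r *.
  rewrite def_a def_r -def_a' -def_r' setUid (wtype_idemP ee).1.
  by rewrite -surjective_pairing.
case: us size_us cov flat_type => // u us; case/lastP: us => // us v _ cov flat_type.
have [Je def_u [K1 [size1 mono1 sub1]]] := cov u (mem_head _ _).
have vs : v \in u :: rcons us v by rewrite inE mem_rcons mem_head orbT.
have [_ def_v [K2 [size2 mono2 sub2]]] := cov v vs.
split; [exact: pumpJ | by rewrite flat_type |].
exists (K1 ++ inr e.1.1 :: K2); split.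
- by rewrite size_cat /=; lia.
- rewrite -[flatten _]/(u ++ flatten (rcons us v)) flatten_rcons.
  apply: mono_cat => //; exists (flatten us), v; split=> //.
  apply/allP=> a /flattenP[w usw wa].
  have [|_ -> _] := cov w; first by rewrite inE mem_rcons inE usw !orbT.
  by rewrite /= !inE.
rewrite imprint_cat /= rel_compA; apply: rel_compS => //; exact: rel_compS.
Qed.

Lemma saturated_separable (J : {set wtype}) : saturated J -> safe J ->
  separable (Sigma 2) (recognized M1) (recognized M2).
Proof.
move=> satJ safeJ; have [J1 Ja Jmul Jpump] := satJ.
have [n cov] : exists n, forall w, exists x, covers J n w x.
  apply: (bounded_factorization (@wtype_mulA _ M1 M2) (@wtype_mul1 _ M1 M2)
    (@wtype_mulr1 _ M1 M2) (@wtype_le_anti _ M1 M2) _ (@wtype_le_mul _ M1 M2)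
    (@wtype_le_pump _ M1 M2) (@wtype_mul_pump _ M1 M2) (@wtype_pump_mul _ M1 M2)
    (val := wtype_letter M1 M2) (f := fun n => n.*2.+1)) => [x|k|k l w x le_kl|
    |a|k u v x y|k e us ee size_us cov].
  - by rewrite /wtype_le eqxx subxx.
  - by rewrite -addnn; lia.
  - case=> Jx def_x [K [size_K monoK subK]]; split=> //; exists K; split=> //.
    exact: leq_trans le_kl.
  - split=> //; exists [::]; split=> //; exact: subxx.
  - split=> //; first by rewrite rel_word1; congr (_, _); apply/setP=> b; rewrite !inE.
    exists [:: inl a]; split=> //=; first by exists [::].
    by rewrite rel_compr1 subxx.
  - case=> Jx def_x [K [sizeK monoK subK]] [Jy def_y [K' [sizeK' monoK' subK']]].
    split; [exact: Jmul|by rewrite alph_cat rel_word_cat /= def_x def_y|].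
    exists (K ++ K'); split; [by rewrite size_cat -addnn; lia|exact: mono_cat|].
    by rewrite imprint_cat; apply: rel_compS.
  exact: covers_pump.
(* Only finitely many monomials have length at most [n]; the separator is the union of those whose
   imprint accepts nothing in [M2]. *)
pose good (K : n.-bseq item) := ~~ meets (imprint K).
exists (fun w => exists2 K, K \in [seq val K | K : n.-bseq item in good] & mono K w).
split; first exact: Sigma2_union.
  move=> w /recognized_meets L1w; have [x [Jx def_x [K [sizeK monoK subK]]]] := cov w.
  exists K => //; apply/imageP; exists (Bseq sizeK) => //.
  apply/negP=> /exists_inP[p ip /exists_inP[q fq pq]].
  apply: (safeJ x Jx); first by rewrite def_x.
  by apply/exists_inP; exists p => //; apply/exists_inP; exists q => //; apply: (subsetP subK).
move=> w [[_ /imageP[K + ->] monoK] /recognizedP[p [q [ip fq pq]]]].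
move=> /negP[]; apply/exists_inP; exists p => //; apply/exists_inP.
by exists q => //; apply: (subsetP (mono_imprint monoK)).
Qed.

End Completeness.

(** * Recursive functions of a list of numbers *)

(* Arguments are read from a list of any length, missing ones being [0]. *)
Definition computable (F : seq nat -> nat) :=
  forall n, @recursive n (fun t => F (tval t)).

Lemma computable_head : computable (head 0).
Proof.
case=> [|n].
  have -> : (fun t : 0.-tuple nat => head 0 (tval t)) = fun _ => 0.
    by apply: functional_extensionality => t; rewrite tuple0.
  exact: recursive_zero.
have -> : (fun t : n.+1.-tuple nat => head 0 (tval t)) = fun t => tnth t ord0.
  by apply: functional_extensionality => t; rewrite [in LHS](tuple_eta t).
exact: recursive_proj.
Qed.

Lemma computable_subst n (f : n.-tuple nat -> nat) (G : 'I_n -> seq nat -> nat) :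
  recursive f -> (forall i, computable (G i)) ->
  computable (fun e => f [tuple G i e | i < n]).
Proof. by move=> rf rG m; apply: (recursive_comp rf) => i; apply: rG. Qed.

Lemma computable_behead F : computable F -> computable (fun e => F (behead e)).
Proof.
move=> rF [|n].
  have -> : (fun t : 0.-tuple nat => F (behead (tval t))) = fun t => F (tval t).
    by apply: functional_extensionality => t; rewrite tuple0.
  exact: rF.
have := recursive_comp (rF n) (fun i : 'I_n => recursive_proj (lift ord0 i)).
congr recursive; apply: functional_extensionality => t; congr F.
rewrite [in RHS](tuple_eta t) /=; apply: (congr1 val (x := [tuple _ | i < n])
  (y := [tuple of behead t])).
by apply: eq_from_tnth => i; rewrite tnth_mktuple [in LHS](tuple_eta t) tnthS.
Qed.

(** Lists act as de Bruijn environments: prepending [N e] binds a new variable to the value of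
    [N]. *)
Lemma computable_cons F N : computable F -> computable N ->
  computable (fun e => F (N e :: e)).
Proof.
move=> rF rN n.
have rG i : @recursive n (if unlift ord0 i is Some j then (fun t => tnth t j) else
    fun t => N (tval t)).
  by case: (unlift ord0 i) => [j|]; [apply: recursive_proj|apply: rN].
have := recursive_comp (rF n.+1) rG.
congr recursive; apply: functional_extensionality => t; congr F.
apply: (congr1 val (x := [tuple _ | i < n.+1]) (y := [tuple of N t :: t])).
apply: eq_from_tnth => i; rewrite tnth_mktuple.
by case: unliftP => [j|] ->; rewrite ?tnthS ?tnth0.
Qed.

Lemma computable_iteri_head F G : computable F -> computable G ->
  computable (fun e => iteri (head 0 e) (fun i acc => G (i :: acc :: behead e))
    (F (behead e))).
Proof.
move=> rF rG [|n].
  have -> : (fun t : 0.-tuple nat => iteri (head 0 t)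
      (fun i acc => G (i :: acc :: behead t)) (F (behead t))) = fun t => F (tval t).
    by apply: functional_extensionality => t; rewrite tuple0.
  exact: rF.
exact: (recursive_primrec (rF n) (rG n.+2)).
Qed.

Lemma computable_iteri N F (G : nat -> nat -> seq nat -> nat) :
  computable N -> computable F ->
  computable (fun e => G (head 0 e) (head 0 (behead e)) (behead (behead e))) ->
  computable (fun e => iteri (N e) (fun i acc => G i acc e) (F e)).
Proof.
by move=> rN rF rG; apply: (computable_cons (computable_iteri_head rF rG) rN).
Qed.

Lemma computable_shift k F : computable F -> computable (fun e => F (iter k behead e)).
Proof.
elim: k F => // k IH F rF; exact: IH (fun e => F (behead e)) (computable_behead rF).
Qed.

Lemma computable_var k : computable (fun e => head 0 (iter k behead e)).
Proof. exact: computable_shift computable_head. Qed.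

Lemma computable_succ F : computable F -> computable (fun e => (F e).+1).
Proof.
move=> rF; have := computable_subst (G := fun _ : 'I_1 => F) recursive_succ (fun=> rF).
by congr computable; apply: functional_extensionality => e; rewrite tnth_mktuple.
Qed.

Lemma computable_const k : computable (fun _ => k).
Proof.
elim: k => [|k IH]; first exact: recursive_zero.
exact: computable_succ IH.
Qed.

Lemma nth_head k e : nth 0 e k = head 0 (iter k behead e).
Proof. by elim: k e => [|k IH] [|x e] //=; rewrite -iterS iterSr //= -IH nth_nil. Qed.

(** Inside a loop the environment starts with the counter and the accumulator; this hides the
    accumulator from a body that reads only the counter. *)
Lemma computable_skip F : computable F ->
  computable (fun e => F (head 0 e :: behead (behead e))).
Proof.
move=> rF n; pose g (i : 'I_n.-2.+1) (t : n.-tuple nat) :=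
  nth 0 t (if val i is j.+1 then j.+2 else 0).
have rg i : recursive (g i).
  have := computable_var (if val i is j.+1 then j.+2 else 0) n.
  by congr recursive; apply: functional_extensionality => t; rewrite /g nth_head.
have := recursive_comp (rF n.-2.+1) rg.
congr recursive; apply: functional_extensionality => t; congr F.
apply: (@eq_from_nth _ 0) => [|i]; rewrite size_tuple.
  by rewrite /= !size_behead size_tuple.
move=> lt_i; rewrite -[i]/(val (Ordinal lt_i)) -tnth_nth tnth_mktuple /g /=.
by case: i lt_i => [|i] _; rewrite ?nth0 //= !nth_behead.
Qed.

Ltac comp_var k := lazymatch k with
  | 20 => fail
  | _ => first [exact: (computable_var k) | comp_var (S k)]
  end.
Ltac comp_leaf := first [assumption | exact: computable_const | comp_var 0].

Lemma eq_computable F G : F =1 G -> computable F -> computable G.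
Proof. by move=> /functional_extensionality ->. Qed.

Definition ball n (P : pred nat) := all P (iota 0 n).
Definition bex n (P : pred nat) := has P (iota 0 n).

Lemma ballP n (P : pred nat) : reflect (forall i, i < n -> P i) (ball n P).
Proof.
apply: (iffP allP) => allP i; first by move=> lt_i; apply: allP; rewrite mem_iota.
by rewrite mem_iota; apply: allP.
Qed.

Lemma bexP n (P : pred nat) : reflect (exists2 i, i < n & P i) (bex n P).
Proof.
by apply: (iffP hasP) => -[i]; rewrite ?mem_iota => lt_i Pi; exists i; rewrite ?mem_iota.
Qed.

Section Closure.

Variables (F G : seq nat -> nat) (P : seq nat -> bool).
Hypotheses (rF : computable F) (rG : computable G) (rP : computable P).

Lemma computable_add : computable (fun e => F e + G e).
Proof.
apply: (@eq_computable (fun e => iteri (G e) (fun _ acc => acc.+1) (F e))).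
  by move=> e; elim: (G e) => [|k IH]; rewrite ?addn0 // addnS -IH.
by apply: computable_iteri => //; apply: computable_succ; comp_leaf.
Qed.

Lemma computable_pred : computable (fun e => (F e).-1).
Proof.
apply: (@eq_computable (fun e => iteri (F e) (fun i _ => i) 0)).
  by move=> e; case: (F e).
by apply: computable_iteri => //; comp_leaf.
Qed.

Lemma computable_not : computable (fun e => ~~ P e).
Proof.
apply: (@eq_computable (fun e => iteri (P e) (fun _ _ => 0) 1)).
  by move=> e; case: (P e).
by apply: computable_iteri => //; comp_leaf.
Qed.

End Closure.

Lemma computable_mul F G : computable F -> computable G -> computable (fun e => F e * G e).
Proof.
move=> rF rG; apply: (@eq_computable (fun e => iteri (G e) (fun _ acc => acc + F e) 0)).
  by move=> e; elim: (G e) => [|k IH]; rewrite ?muln0 // mulnSr -IH.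
apply: computable_iteri => //; first by comp_leaf.
by apply: computable_add; [comp_leaf|apply: (computable_shift 2)].
Qed.

Lemma computable_and (P Q : seq nat -> bool) :
  computable P -> computable Q -> computable (fun e => P e && Q e).
Proof.
move=> rP rQ; apply: (@eq_computable (fun e => P e * Q e)); last exact: computable_mul.
by move=> e; case: (P e); case: (Q e).
Qed.

Lemma computable_or (P Q : seq nat -> bool) :
  computable P -> computable Q -> computable (fun e => P e || Q e).
Proof.
move=> rP rQ; apply: (@eq_computable (fun e => ~~ (~~ P e && ~~ Q e))).
  by move=> e; case: (P e); case: (Q e).
by do 2!apply: computable_not || apply: computable_and; apply: computable_not.
Qed.

Lemma computable_imp (P Q : seq nat -> bool) :
  computable P -> computable Q -> computable (fun e => P e ==> Q e).
Proof.
move=> rP rQ; apply: (@eq_computable (fun e => ~~ P e || Q e)).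
  by move=> e; case: (P e).
by apply: computable_or => //; apply: computable_not.
Qed.

Lemma computable_eqb (P Q : seq nat -> bool) :
  computable P -> computable Q -> computable (fun e => P e == Q e).
Proof.
move=> rP rQ; apply: (@eq_computable (fun e => (P e ==> Q e) && (Q e ==> P e))).
  by move=> e; case: (P e); case: (Q e).
by apply: computable_and; apply: computable_imp.
Qed.

Lemma computable_leq F G : computable F -> computable G -> computable (fun e => F e <= G e).
Proof.
move=> rF rG.
apply: (@eq_computable (fun e => iteri (iteri (G e) (fun _ acc => acc.-1) (F e))
  (fun _ _ => 0) 1)).
  move=> e; have -> : iteri (G e) (fun _ acc => acc.-1) (F e) = F e - G e.
    by elim: (G e) => [|k IH]; rewrite ?subn0 // subnS -IH.
  by rewrite /leq; case: (F e - G e).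
apply: computable_iteri; try comp_leaf.
by apply: computable_iteri => //; apply: computable_pred; comp_leaf.
Qed.

Lemma computable_eqn F G : computable F -> computable G -> computable (fun e => F e == G e).
Proof.
move=> rF rG; apply: (@eq_computable (fun e => (F e <= G e) && (G e <= F e))).
  by move=> e; rewrite eqn_leq.
by apply: computable_and; apply: computable_leq.
Qed.

Lemma computable_exp2 F : computable F -> computable (fun e => 2 ^ F e).
Proof.
move=> rF; apply: (@eq_computable (fun e => iteri (F e) (fun _ acc => acc + acc) 1)).
  by move=> e; elim: (F e) => // k IH; rewrite expnS mul2n -addnn -IH.
apply: computable_iteri => //; first by comp_leaf.
by apply: computable_add; comp_leaf.
Qed.

Lemma computable_ball N (P : nat -> seq nat -> bool) : computable N ->
  computable (fun e => P (head 0 e) (behead e)) ->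
  computable (fun e => ball (N e) (fun i => P i e)).
Proof.
move=> rN rP; apply: (@eq_computable
  (fun e => iteri (N e) (fun i acc => (0 < acc) && P i e) true)).
  move=> e; rewrite /ball; elim: (N e) => // k IH.
  by rewrite -addn1 iotaD all_cat /= andbT addn1 /= {}IH lt0b.
apply: computable_iteri => //; first by comp_leaf.
apply: computable_and; first by apply: computable_leq; comp_leaf.
exact: computable_skip rP.
Qed.

Lemma computable_bex N (P : nat -> seq nat -> bool) : computable N ->
  computable (fun e => P (head 0 e) (behead e)) ->
  computable (fun e => bex (N e) (fun i => P i e)).
Proof.
move=> rN rP; apply: (@eq_computable (fun e => ~~ ball (N e) (fun i => ~~ P i e))).
  by move=> e; rewrite /ball /bex (all_predC (P ^~ e)) negbK.
by apply/computable_not/computable_ball => //; apply: computable_not.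
Qed.

Lemma computable_iter N F (f : nat -> nat) : computable N -> computable F ->
  computable (fun e => f (head 0 e)) -> computable (fun e => iter (N e) f (F e)).
Proof.
move=> rN rF rf; apply: (@eq_computable (fun e => iteri (N e) (fun _ acc => f acc) (F e))).
  by move=> e; elim: (N e) => //= k ->.
apply: computable_iteri => //.
exact: (computable_shift 1 rf).
Qed.

Lemma computable_odd F : computable F -> computable (fun e => odd (F e)).
Proof.
move=> rF; apply: (@eq_computable (fun e => iteri (F e) (fun _ acc => acc == 0) 0)).
  by move=> e; elim: (F e) => //= k ->; rewrite eqb0.
by apply: computable_iteri => //; [|apply: computable_eqn]; comp_leaf.
Qed.

Lemma computable_half F : computable F -> computable (fun e => (F e)./2).
Proof.
move=> rF; apply: (@eq_computable (fun e => iteri (F e) (fun i acc => odd i + acc) 0)).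
  by move=> e; elim: (F e) => //= k ->; rewrite uphalf_half.
apply: computable_iteri => //; first by comp_leaf.
by apply: computable_add; [apply: computable_odd|]; comp_leaf.
Qed.

(** * Bits and list codes *)

Definition bit z i := odd (iter i half z).

Lemma computable_bit F G : computable F -> computable G -> computable (fun e => bit (F e) (G e)).
Proof.
move=> rF rG; apply: computable_odd; apply: computable_iter => //.
exact: computable_half computable_head.
Qed.

(** The head of a code is its number of trailing zero bits: [acc] advances until it meets a one. For
    the code of a nonempty list [z] rounds suffice, as its head is at most [z]. *)
Definition code_head z := iteri z (fun _ acc => acc + ~~ bit z acc) 0.
Definition code_tail z := iter (code_head z).+1 half z.
(** Only the empty list has code [0], and the length of a list is at most its code; hence the
    positivity test and the bound [z] on the number of tails. *)
Definition code_mem i z :=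
  bex z (fun k => (0 < iter k code_tail z) && (code_head (iter k code_tail z) == i)).

Lemma computable_code_head F : computable F -> computable (fun e => code_head (F e)).
Proof.
move=> rF; apply: computable_iteri => //; first by comp_leaf.
apply: computable_add; first by comp_leaf.
apply: computable_not; apply: computable_bit; last by comp_leaf.
exact: (computable_shift 2).
Qed.

Lemma computable_code_tail F : computable F -> computable (fun e => code_tail (F e)).
Proof.
move=> rF; apply: computable_iter => //; first exact/computable_succ/computable_code_head.
exact: computable_half computable_head.
Qed.

Lemma computable_code_mem F G :
  computable F -> computable G -> computable (fun e => code_mem (F e) (G e)).
Proof.
move=> rF rG.
have r_iter : computable (fun e => iter (head 0 e) code_tail (G (behead e))).
  apply: computable_iter; first exact: computable_head.
    exact: (computable_shift 1).
  exact: computable_code_tail computable_head.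
apply: computable_bex => //; apply: computable_and.
  by apply: computable_leq => //; comp_leaf.
apply: computable_eqn; first exact: computable_code_head.
exact: (computable_shift 1).
Qed.

Ltac comp := repeat (cbv beta; lazymatch goal with
  | |- computable (fun e => nat_of_bool (andb _ _)) => apply: computable_and
  | |- computable (fun e => nat_of_bool (orb _ _)) => apply: computable_or
  | |- computable (fun e => nat_of_bool (implb _ _)) => apply: computable_imp
  | |- computable (fun e => nat_of_bool (negb _)) => apply: computable_not
  | |- computable (fun e => nat_of_bool (bit _ _)) => apply: computable_bit
  | |- computable (fun e => nat_of_bool (code_mem _ _)) => apply: computable_code_mem
  | |- computable (fun e => nat_of_bool (ball _ _)) => apply: computable_ball
  | |- computable (fun e => nat_of_bool (bex _ _)) => apply: computable_bex
  | |- computable (fun e => nat_of_bool (@eq_op _ _ _)) =>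
    first [apply: computable_eqn | apply: computable_eqb]
  | |- computable (fun e => addn _ _) => apply: computable_add
  | |- computable (fun e => muln _ _) => apply: computable_mul
  | |- computable (fun e => S _) => apply: computable_succ
  | |- computable (fun e => expn 2 _) => apply: computable_exp2
  | |- computable (fun e => code_head _) => apply: computable_code_head
  | |- computable (fun e => code_tail _) => apply: computable_code_tail
  | |- _ => comp_leaf
  end).

Lemma bit0 (b : bool) z : bit (b + z.*2) 0 = b.
Proof. by rewrite /bit /= oddD odd_double addbF oddb. Qed.

Lemma bitS (b : bool) z i : bit (b + z.*2) i.+1 = bit z i.
Proof. by rewrite /bit iterSr half_bit_double. Qed.

Fixpoint mkbits n (P : pred nat) : nat :=
  if n is m.+1 then P 0 + (mkbits m (P \o succn)).*2 else 0.

Lemma bit_mkbits n (P : pred nat) i : bit (mkbits n P) i = (i < n) && P i.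
Proof.
elim: n P i => [|n IH] P [|i] //=; rewrite ?bit0 ?bitS ?IH //.
by rewrite /bit; elim: i => // i IH; rewrite iterSr.
Qed.

Lemma mkbits_lt n P : mkbits n P < 2 ^ n.
Proof.
elim: n P => //= n IH P; have := IH (P \o succn); rewrite expnS mul2n.
by case: (P 0); lia.
Qed.

Lemma set_bits (T : finType) (pos : T -> nat) m (X : {set T}) : injective pos ->
  (forall t, pos t < m) -> exists2 z, z < 2 ^ m & forall t, bit z (pos t) = (t \in X).
Proof.
move=> pos_inj pos_lt; pose P i := [exists t in X, pos t == i].
exists (mkbits m P) => [|t]; first exact: mkbits_lt.
rewrite bit_mkbits pos_lt; apply/exists_inP/idP => [[t' Xt' /eqP/pos_inj <-]|Xt] //.
by exists t.
Qed.

Lemma iter_half_exp2 n m k : k <= n -> iter k half (2 ^ n * m) = 2 ^ (n - k) * m.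
Proof.
elim: k => [|k IH] lt_k; first by rewrite subn0.
rewrite iterS IH ?(ltnW lt_k) // -(subnSK lt_k) expnS -mulnA mul2n.
exact: doubleK.
Qed.

Lemma code_headE n s : code_head (CodeSeq.code (n :: s)) = n.
Proof.
set z := CodeSeq.code _; have def_z : z = 2 ^ n * (CodeSeq.code s).*2.+1 by [].
have bit_z k : k <= n -> bit z k = (k == n).
  move=> le_k; rewrite /bit def_z iter_half_exp2 // oddM oddX /= odd_double andbT.
  by rewrite orbF subn_eq0 eqn_leq le_k.
have le_nz : n <= z.
  rewrite def_z; apply: leq_trans (leq_pmulr _ (ltn0Sn _)); exact/ltnW/ltn_expl.
have count k : iteri k (fun _ acc => acc + ~~ bit z acc) 0 = minn k n.
  elim: k => [|k IH] /=; first by rewrite min0n.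
  by rewrite IH bit_z ?geq_minr //; lia.
by rewrite /code_head count; apply/minn_idPr.
Qed.

Lemma code_tailE n s : code_tail (CodeSeq.code (n :: s)) = CodeSeq.code s.
Proof.
rewrite /code_tail code_headE iterS -[CodeSeq.code _]/(2 ^ n * (CodeSeq.code s).*2.+1).
by rewrite iter_half_exp2 // subnn mul1n /= uphalf_double.
Qed.

Lemma code_memE i s : code_mem i (CodeSeq.code s) = (i \in s).
Proof.
have tails k : iter k code_tail (CodeSeq.code s) = CodeSeq.code (drop k s).
  elim: k => [|k IH]; first by rewrite drop0.
  rewrite iterS IH -addn1 addnC -drop_drop.
  case: (drop k s) => [|n t]; last by rewrite code_tailE /= drop0.
  by rewrite /code_tail.
have code_gt0 t : (0 < CodeSeq.code t) = (0 < size t).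
  by case: t => // n t; rewrite /= muln_gt0 expn_gt0.
have size_code t : size t <= CodeSeq.code t.
  elim: t => // n t IH; rewrite /= (leq_trans _ (leq_pmull _ _)) ?expn_gt0 //; lia.
apply/bexP/idP => [[k _]|s_i].
  rewrite tails code_gt0; case def_t: (drop k s) => [|n t] //= /eqP.
  by rewrite code_headE => <-; apply: (@mem_drop k); rewrite def_t mem_head.
exists (index i s); first by rewrite (leq_trans _ (size_code s)) ?index_mem.
rewrite tails code_gt0 (drop_nth 0) ?index_mem // code_headE nth_index //= eqxx.
Qed.

(** * The decision procedure on numbers *)

Definition is_initial c p := code_mem p (code_head (code_tail c)).
Definition is_final c p := code_mem p (code_head (code_tail (code_tail c))).
(** This is [CodeSeq.code (n :: s)] when [m] is the code of [s], written with operations that [comp]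
    handles. *)
Definition code_pair n m := 2 ^ n * (m + m).+1.
Definition is_trans c p l q :=
  code_mem (code_pair p (code_pair l (code_pair q 0)))
    (code_head (code_tail (code_tail (code_tail c)))).

Local Notation rank x := (val (enum_rank x)).

Lemma rank_mem (T : finType) (X : {set T}) x :
  (rank x \in [seq rank y | y <- enum X]) = (x \in X).
Proof.
rewrite -[LHS]/((fun y => rank y) x \in _) mem_map ?mem_enum //.
by move=> y z /val_inj/enum_rank_inj.
Qed.

Section Encoding.

Variables (A : finType) (M : nfa A).

Lemma code_states : code_head (nfa_code M) = #|state M|.
Proof. exact: code_headE. Qed.

Lemma is_initialE p : is_initial (nfa_code M) (rank p) = (p \in initial M).
Proof. by rewrite /is_initial code_tailE code_headE code_memE rank_mem. Qed.

Lemma is_finalE p : is_final (nfa_code M) (rank p) = (p \in final M).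
Proof. by rewrite /is_final !code_tailE code_headE code_memE rank_mem. Qed.

Lemma is_transE p a q :
  is_trans (nfa_code M) (rank p) (rank a) (rank q) = ((p, a, q) \in trans M).
Proof.
rewrite /is_trans !code_tailE code_headE code_memE.
have -> : code_pair (rank p) (code_pair (rank a) (code_pair (rank q) 0))
    = CodeSeq.code [:: rank p; rank a; rank q] by rewrite /code_pair !addnn.
rewrite -[LHS]/((fun t : state M * A * state M =>
  CodeSeq.code [:: rank t.1.1; rank t.1.2; rank t.2]) (p, a, q) \in _).
rewrite mem_map ?mem_enum //.
move=> [[p1 a1] q1] [[p2 a2] q2] /(can_inj CodeSeq.codeK)[].
by move=> /val_inj/enum_rank_inj -> /val_inj/enum_rank_inj -> /val_inj/enum_rank_inj ->.
Qed.

End Encoding.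

Section RankQuantifiers.

Variable T : finType.

Lemma ball_rankP (P : pred nat) : reflect (forall x : T, P (rank x)) (ball #|T| P).
Proof.
apply: (iffP (ballP _ _)) => [allP x|allP i lt_i]; first exact: allP (ltn_ord _).
by have := allP (enum_val (Ordinal lt_i)); rewrite enum_valK.
Qed.

Lemma bex_rankP (P : pred nat) : reflect (exists x : T, P (rank x)) (bex #|T| P).
Proof.
apply: (iffP (bexP _ _)) => [[i lt_i]|[x Px]]; last by exists (rank x); rewrite ?ltn_ord.
by exists (enum_val (Ordinal lt_i)); rewrite enum_valK.
Qed.

End RankQuantifiers.

(* A number encodes a triple: the bits below [a] are the set of letters, the
   next [n1 * n1] bits the relation on [M1], the last [n2 * n2] bits that on
   [M2]; the offset [o] tells which relation is meant. *)
Definition pair_bit o n z p q := bit z (o + (p * n + q)).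
Definition ball2 n (P : nat -> nat -> bool) := ball n (fun p => ball n (P p)).

Definition num_alph_id a z := ball a (fun l => ~~ bit z l).
Definition num_alph_letter a l z := ball a (fun k => bit z k == (k == l)).
Definition num_alph_mul a x y z := ball a (fun k => bit z k == (bit x k || bit y k)).
Definition num_alph_eq a x z := ball a (fun k => bit z k == bit x k).

Definition num_id o n z := ball2 n (fun p q => pair_bit o n z p q == (p == q)).
Definition num_letter o n c l z :=
  ball2 n (fun p q => pair_bit o n z p q == is_trans c p l q).
Definition num_mul o n x y z := ball2 n (fun p q => pair_bit o n z p q ==
  bex n (fun r => pair_bit o n x p r && pair_bit o n y r q)).
Definition num_eq o n x z :=
  ball2 n (fun p q => pair_bit o n z p q == pair_bit o n x p q).
(* [q] is reachable from [p] iff it lies in every set of states containing [p]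
   and closed under the transitions allowed by [x]. *)
Definition num_reach a n c x p q := ball (2 ^ n) (fun X =>
  bit X p && ball n (fun r => ball n (fun s => ball a (fun l =>
    [&& bit X r, bit x l & is_trans c r l s] ==> bit X s))) ==> bit X q).
Definition num_pump a o n c x z := ball2 n (fun p q => pair_bit o n z p q ==
  bex n (fun r => bex n (fun s =>
    [&& pair_bit o n x p r, num_reach a n c x r s & pair_bit o n x s q]))).
Definition num_meets o n c x := bex n (fun p => bex n (fun q =>
  [&& is_initial c p, is_final c q & pair_bit o n x p q])).

Section RelationBits.

Variables (A : finType) (M : nfa A) (o : nat).
Local Notation Q := (state M).
Local Notation n := #|Q|.

Definition rel_of z : {set Q * Q} :=
  [set pq | pair_bit o n z (rank pq.1) (rank pq.2)].
Definition alph_of z : {set A} := [set l | bit z (rank l)].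

Lemma in_rel_of z p q : ((p, q) \in rel_of z) = pair_bit o n z (rank p) (rank q).
Proof. by rewrite inE. Qed.

Lemma ball2_relP z (R : {set Q * Q}) (P : nat -> nat -> bool) :
  (forall p q : Q, P (rank p) (rank q) = ((p, q) \in R)) ->
  reflect (rel_of z = R) (ball2 n (fun p q => pair_bit o n z p q == P p q)).
Proof.
move=> defP; apply: (iffP (ball_rankP _ _)) => [allP|def_R p].
  apply/setP=> -[p q]; rewrite in_rel_of -defP; apply/eqP.
  exact: (ball_rankP _ _ (allP p)).
by apply/ball_rankP=> q; rewrite defP -def_R in_rel_of.
Qed.

Lemma ball_alphP z (B : {set A}) (P : nat -> bool) :
  (forall l : A, P (rank l) = (l \in B)) ->
  reflect (alph_of z = B) (ball #|A| (fun l => bit z l == P l)).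
Proof.
move=> defP; apply: (iffP (ball_rankP _ _)) => [allP|def_B l].
  by apply/setP=> l; rewrite inE -defP; apply/eqP.
by rewrite defP -def_B inE.
Qed.

Lemma rank_eq (T : finType) (x y : T) : (rank x == rank y) = (x == y).
Proof. by rewrite (inj_eq val_inj) (inj_eq enum_rank_inj). Qed.

Lemma num_idP z : reflect (rel_of z = rel_id M) (num_id o n z).
Proof. by apply: ball2_relP => p q; rewrite rank_eq inE. Qed.

Lemma num_letterP l z :
  reflect (rel_of z = rel_letter M l) (num_letter o n (nfa_code M) (rank l) z).
Proof. by apply: ball2_relP => p q; rewrite is_transE inE. Qed.

Lemma num_mulP x y z :
  reflect (rel_of z = rel_comp (rel_of x) (rel_of y)) (num_mul o n x y z).
Proof.
apply: ball2_relP => p q; apply/bex_rankP/rel_compP => [[r /andP[pr rq]]|[r]].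
  by exists r; rewrite in_rel_of.
by rewrite !in_rel_of => pr rq; exists r; rewrite pr.
Qed.

Lemma num_eqP x z : reflect (rel_of z = rel_of x) (num_eq o n x z).
Proof. by apply: ball2_relP => p q; rewrite in_rel_of. Qed.

Lemma num_reachP x p q :
  num_reach #|A| n (nfa_code M) x (rank p) (rank q) = ((p, q) \in rel_star M (alph_of x)).
Proof.
apply/ballP/rel_starP => [closed_q|[v Bv pq] X _]; last first.
  apply/implyP=> /andP[Xp closed_X].
  elim: v p Bv pq Xp => [|a v IH] p /=; first by rewrite inE => _ /eqP /= ->.
  case/andP=> Ba Bv /rel_compP[r]; rewrite inE => par rq Xp; apply: IH Bv rq _.
  have /ball_rankP/(_ r)/ball_rankP/(_ a) := ball_rankP _ _ closed_X p.
  by rewrite Xp is_transE par andbT /=; move: Ba; rewrite inE => ->.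
(* Among the tested sets is the set of states reachable from [p], which is closed. *)
have [X lt_X bit_X] := @set_bits Q (fun r => rank r) n
  [set r | (p, r) \in rel_star M (alph_of x)] (inj_comp val_inj enum_rank_inj)
  (fun r => ltn_ord _).
have := closed_q X lt_X; rewrite !bit_X !inE connect0 /=.
move/implyP=> reach_q; apply/rel_starP; rewrite inE; apply: reach_q.
apply/ball_rankP=> r; apply/ball_rankP=> s; apply/ball_rankP=> a.
rewrite !bit_X is_transE !inE; apply/implyP=> /and3P[pr xa ras].
apply: connect_trans pr (connect1 _); apply/exists_inP; exists a => //.
by rewrite inE.
Qed.

Lemma num_pumpP x z : reflect (rel_of z = rel_pump (alph_of x) (rel_of x))
  (num_pump #|A| o n (nfa_code M) x z).
Proof.
apply: ball2_relP => p q; apply/bex_rankP/rel_compP => [[r /bex_rankP[s /and3P[pr rs sq]]]|].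
  exists s; rewrite ?in_rel_of //; apply/rel_compP; exists r; rewrite ?in_rel_of //.
  by rewrite -num_reachP.
case=> s /rel_compP[r]; rewrite !in_rel_of => pr rs sq; exists r; apply/bex_rankP.
by exists s; rewrite pr num_reachP rs.
Qed.

Lemma num_meetsE x : num_meets o n (nfa_code M) x = meets (rel_of x).
Proof.
apply/bex_rankP/exists_inP => [[p /bex_rankP[q]]|[p ip /exists_inP[q fq pq]]].
  rewrite is_initialE is_finalE => /and3P[ip fq pq]; exists p => //.
  by apply/exists_inP; exists q; rewrite ?in_rel_of.
by exists p; apply/bex_rankP; exists q; rewrite is_initialE is_finalE ip fq -in_rel_of.
Qed.

End RelationBits.

(** Products and pumped triples are not computed: every [z] below [2 ^ w] with the right bits must
    belong to [J], so that bounded quantifiers and bit tests are enough. *)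
Definition num_saturated a n1 n2 c1 c2 w J :=
  let o1 := a in let o2 := a + n1 * n1 in
  [&& ball (2 ^ w) (fun z =>
        [&& num_alph_id a z, num_id o1 n1 z & num_id o2 n2 z] ==> bit J z),
      ball a (fun l => ball (2 ^ w) (fun z =>
        [&& num_alph_letter a l z, num_letter o1 n1 c1 l z & num_letter o2 n2 c2 l z]
        ==> bit J z)),
      ball (2 ^ w) (fun x => ball (2 ^ w) (fun y => ball (2 ^ w) (fun z =>
        [&& bit J x, bit J y, num_alph_mul a x y z, num_mul o1 n1 x y z &
            num_mul o2 n2 x y z] ==> bit J z))) &
      ball (2 ^ w) (fun x => ball (2 ^ w) (fun z =>
        [&& bit J x, num_mul o1 n1 x x x, num_mul o2 n2 x x x, num_alph_eq a x z,
            num_eq o1 n1 x z & num_pump a o2 n2 c2 x z] ==> bit J z))].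

Definition num_safe a n1 n2 c1 c2 w J := ball (2 ^ w) (fun x =>
  ~~ [&& bit J x, num_meets a n1 c1 x & num_meets (a + n1 * n1) n2 c2 x]).

Definition num_separable a c1 c2 :=
  let n1 := code_head c1 in let n2 := code_head c2 in
  let w := a + n1 * n1 + n2 * n2 in
  bex (2 ^ (2 ^ w)) (fun J =>
    num_saturated a n1 n2 c1 c2 w J && num_safe a n1 n2 c1 c2 w J).

Lemma computable_num_separable : computable (fun e =>
  num_separable (head 0 e) (head 0 (behead e)) (head 0 (behead (behead e)))).
Proof.
rewrite /num_separable /num_safe /num_saturated /num_meets /num_pump /num_reach
  /num_eq /num_mul /num_letter /num_id /num_alph_eq /num_alph_mul /num_alph_letter
  /num_alph_id /ball2 /pair_bit /is_trans /is_initial /is_final /code_pair.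
cbv zeta; comp.
Qed.

(** * The numeric test agrees with the existence of a saturated safe set *)

Section NumericCorrectness.

Variables (A : finType) (M1 M2 : nfa A).
Local Notation a := #|A|.
Local Notation n1 := #|state M1|.
Local Notation n2 := #|state M2|.
Local Notation c1 := (nfa_code M1).
Local Notation c2 := (nfa_code M2).
Local Notation o2 := (a + n1 * n1).
Local Notation w := (o2 + n2 * n2).
Local Notation wtype := (wtype M1 M2).

Definition wtype_of z : wtype := (alph_of A z, rel_of M1 a z, rel_of M2 o2 z).

Definition bit_position
    (t : A + (state M1 * state M1 + state M2 * state M2)) : nat :=
  match t with
  | inl l => rank l
  | inr (inl (p, q)) => a + (rank p * n1 + rank q)
  | inr (inr (p, q)) => o2 + (rank p * n2 + rank q)
  end.

Lemma rank_lt (T : finType) (x : T) : rank x < #|T|.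
Proof. exact: ltn_ord. Qed.

Lemma pair_lt (T : finType) (p q : T) : rank p * #|T| + rank q < #|T| * #|T|.
Proof.
apply: (@leq_trans ((rank p).+1 * #|T|)); last by rewrite leq_mul2r ltn_ord orbT.
by rewrite mulSn [_ + rank p * _]addnC ltn_add2l ltn_ord.
Qed.

Lemma pair_inj (T : finType) (p q p' q' : T) :
  rank p * #|T| + rank q = rank p' * #|T| + rank q' -> (p, q) = (p', q').
Proof.
have := ltn_ord (enum_rank q); have := ltn_ord (enum_rank q') => lt_q' lt_q eq_pq.
have eq_q : rank q = rank q' by have := congr1 (modn^~ #|T|) eq_pq; rewrite !modnMDl !modn_small.
have eq_p : rank p = rank p'.
  move: eq_pq; rewrite eq_q => /addIn/eqP; rewrite eqn_pmul2r; first by move/eqP.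
  exact: leq_ltn_trans lt_q.
by rewrite (enum_rank_inj (val_inj eq_q)) (enum_rank_inj (val_inj eq_p)).
Qed.

Lemma bit_position_inj : injective bit_position.
Proof.
case=> [l|[[p q]|[p q]]] [l'|[[p' q']|[p' q']]]; cbv beta iota delta [bit_position].
- by move/val_inj/enum_rank_inj ->.
- by have := rank_lt l; lia.
- by have := rank_lt l; lia.
- by have := rank_lt l'; lia.
- by move/addnI/pair_inj ->.
- by have := pair_lt p q; lia.
- by have := rank_lt l'; lia.
- by have := pair_lt p' q'; lia.
- by move/addnI/pair_inj ->.
Qed.

Lemma bit_position_lt t : bit_position t < w.
Proof.
case: t => [l|[[p q]|[p q]]]; cbv beta iota delta [bit_position].
- by have := rank_lt l; lia.
- by have := pair_lt p q; lia.
- by have := pair_lt p q; lia.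
Qed.

(** The letters and pairs that make up a triple own distinct bits below [w], so numbers below
    [2 ^ w] reach all triples. *)
Lemma wtype_of_surj (x : wtype) : exists2 z, z < 2 ^ w & wtype_of z = x.
Proof.
pose X := [set t : A + (state M1 * state M1 + state M2 * state M2) | match t with
  | inl l => l \in x.1.1 | inr (inl pq) => pq \in x.1.2 | inr (inr pq) => pq \in x.2 end].
have [z lt_z bit_z] := set_bits X bit_position_inj bit_position_lt; exists z => //.
rewrite [x]surjective_pairing [x.1]surjective_pairing; congr (_, _, _); apply/setP.
- by move=> l; rewrite inE [LHS](bit_z (inl l)) /X inE.
- by move=> [p q]; rewrite inE [LHS](bit_z (inr (inl (p, q)))) /X inE.
- by move=> [p q]; rewrite inE [LHS](bit_z (inr (inr (p, q)))) /X inE.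
Qed.

Lemma num_oneP z : reflect (wtype_of z = wtype_one M1 M2)
  [&& num_alph_id a z, num_id a n1 z & num_id o2 n2 z].
Proof.
have alphP : reflect (alph_of A z = set0) (num_alph_id a z).
  apply: (iffP (ball_rankP _ _)) => [none|def_B l].
    by apply/setP=> l; rewrite !inE; apply/negbTE.
  by have /setP/(_ l) := def_B; rewrite !inE => ->.
by apply: (iffP and3P) => [[/alphP e1 /num_idP e2 /num_idP e3]|[e1 e2 e3]];
  [congr (_, _, _)|split; [apply/alphP|apply/num_idP|apply/num_idP]].
Qed.

Lemma num_wtype_letterP l z : reflect (wtype_of z = wtype_letter M1 M2 l)
  [&& num_alph_letter a (rank l) z, num_letter a n1 c1 (rank l) z &
      num_letter o2 n2 c2 (rank l) z].
Proof.
have alphP : reflect (alph_of A z = [set l]) (num_alph_letter a (rank l) z).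
  by apply: ball_alphP => k; rewrite rank_eq inE.
by apply: (iffP and3P) => [[/alphP e1 /num_letterP e2 /num_letterP e3]|[e1 e2 e3]];
  [congr (_, _, _)|split; [apply/alphP|apply/num_letterP|apply/num_letterP]].
Qed.

Lemma num_wtype_mulP x y z : reflect (wtype_of z = wtype_mul (wtype_of x) (wtype_of y))
  [&& num_alph_mul a x y z, num_mul a n1 x y z & num_mul o2 n2 x y z].
Proof.
have alphP : reflect (alph_of A z = alph_of A x :|: alph_of A y) (num_alph_mul a x y z).
  by apply: ball_alphP => k; rewrite !inE.
by apply: (iffP and3P) => [[/alphP e1 /num_mulP e2 /num_mulP e3]|[e1 e2 e3]];
  [congr (_, _, _)|split; [apply/alphP|apply/num_mulP|apply/num_mulP]].
Qed.

Lemma num_idemP x : reflect (wtype_mul (wtype_of x) (wtype_of x) = wtype_of x)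
  (num_mul a n1 x x x && num_mul o2 n2 x x x).
Proof.
apply: (iffP andP) => [[/num_mulP e1 /num_mulP e2]|[_ e1 e2]].
  by rewrite /wtype_mul /= setUid -e1 -e2.
by split; apply/num_mulP.
Qed.

Lemma num_wtype_pumpP x z : reflect (wtype_of z = wtype_pump (wtype_of x))
  [&& num_alph_eq a x z, num_eq a n1 x z & num_pump a o2 n2 c2 x z].
Proof.
have alphP : reflect (alph_of A z = alph_of A x) (num_alph_eq a x z).
  by apply: ball_alphP => k; rewrite inE.
by apply: (iffP and3P) => [[/alphP e1 /num_eqP e2 /num_pumpP e3]|[e1 e2 e3]];
  [congr (_, _, _)|split; [apply/alphP|apply/num_eqP|apply/num_pumpP]].
Qed.

Lemma num_separableP : num_separable a c1 c2 <->
  exists J : {set wtype}, saturated J /\ safe J.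
Proof.
rewrite /num_separable !code_states; split.
  case/bexP=> J _ /andP[/and4P[/ballP one /ball_rankP letters /ballP muls /ballP pumps]
    /ballP safes].
  pose JJ := [set wtype_of z | z : 'I_(2 ^ w) & bit J z].
  have JJ_in z : z < 2 ^ w -> bit J z -> wtype_of z \in JJ.
    by move=> lt_z Jz; apply/imsetP; exists (Ordinal lt_z); rewrite ?inE.
  have JJ_out x : x \in JJ -> exists2 z, z < 2 ^ w & bit J z /\ wtype_of z = x.
    by case/imsetP=> z; rewrite inE => Jz ->; exists (val z); rewrite ?ltn_ord.
  exists JJ; split; first split.
  - have [z lt_z def_z] := wtype_of_surj (wtype_one M1 M2); rewrite -def_z.
    by apply: JJ_in => //; apply: (implyP (one z lt_z)); apply/num_oneP.
  - move=> l; have [z lt_z def_z] := wtype_of_surj (wtype_letter M1 M2 l); rewrite -def_z.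
    apply: JJ_in => //; have /ballP/(_ z lt_z)/implyP := letters l; apply.
    exact/num_wtype_letterP.
  - move=> _ _ /JJ_out[x lt_x [Jx <-]] /JJ_out[y lt_y [Jy <-]].
    have [z lt_z def_z] := wtype_of_surj (wtype_mul (wtype_of x) (wtype_of y)).
    rewrite -def_z; apply: JJ_in => //.
    have /ballP/(_ y lt_y)/ballP/(_ z lt_z)/implyP := muls x lt_x; apply.
    by rewrite Jx Jy; apply/num_wtype_mulP.
  - move=> _ /JJ_out[x lt_x [Jx <-]] /num_idemP/andP[xx1 xx2].
    have [z lt_z def_z] := wtype_of_surj (wtype_pump (wtype_of x)).
    rewrite -def_z; apply: JJ_in => //.
    have /ballP/(_ z lt_z)/implyP := pumps x lt_x; apply.
    by rewrite Jx xx1 xx2; apply/num_wtype_pumpP.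
  move=> _ /JJ_out[x lt_x [Jx <-]] meets1 meets2; have := safes x lt_x.
  by rewrite Jx !num_meetsE meets1 meets2.
case=> J [[one letters muls pumps] safeJ].
(* A set of triples is encoded by its characteristic sequence over all codes, [2 ^ w] bits long;
   this explains the bound [2 ^ (2 ^ w)]. *)
pose P z := wtype_of z \in J; have bitP z : z < 2 ^ w -> bit (mkbits (2 ^ w) P) z = P z.
  by rewrite bit_mkbits => ->.
apply/bexP; exists (mkbits (2 ^ w) P); first exact: mkbits_lt.
apply/andP; split; first (apply/and4P; split).
- apply/ballP=> z lt_z; apply/implyP=> /num_oneP def_z.
  by rewrite bitP // /P def_z.
- apply/ball_rankP=> l; apply/ballP=> z lt_z; apply/implyP=> /num_wtype_letterP def_z.
  by rewrite bitP // /P def_z.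
- apply/ballP=> x lt_x; apply/ballP=> y lt_y; apply/ballP=> z lt_z; apply/implyP.
  rewrite !bitP // => /and3P[Jx Jy /num_wtype_mulP def_z].
  by rewrite /P def_z; apply: muls.
- apply/ballP=> x lt_x; apply/ballP=> z lt_z; apply/implyP.
  rewrite !bitP // => /and4P[Jx xx1 xx2 /num_wtype_pumpP def_z].
  by rewrite /P def_z; apply: pumps => //; apply/num_idemP; rewrite xx1.
apply/ballP=> x lt_x; apply/and3P; rewrite bitP // !num_meetsE => -[Jx m1 m2].
exact: (safeJ _ Jx m1 m2).
Qed.

End NumericCorrectness.

(** * Duality between Sigma_2 and Pi_2 *)

Section Complement.

Variable A : finType.
Implicit Types (f g : formula A).

Lemma prenex_steps_not f g : prenex_steps f g -> prenex_steps (Not f) (Not g).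
Proof.
elim=> [f1|f1 f2 f3 st _]; first exact: prenex_refl.
by apply: prenex_trans; apply: step_not.
Qed.

Lemma prenex_not g : prenex g -> exists h,
  [/\ prenex_steps (Not g) h, prenex h & prefix_of h = map negb (prefix_of g)].
Proof.
elim: g => [a x|x y|x y|f _|c f _ f' _|q g IH] /= pre.
1-5: by eexists; split; first exact: prenex_refl.
have [h [st preh def_h]] := IH pre; exists (Quant (dual q) h); split=> //=.
  exact: prenex_trans (pull_not q g) (prenex_steps_quant _ st).
by rewrite def_h; case: q.
Qed.

Lemma nblocks_negb s : nblocks (map negb s) = nblocks s.
Proof. by elim: s => //= b s ->; case: s => [|c s] /=; case: b => //; case: c. Qed.

Lemma alternation_not b i f : alternation b i f -> alternation (~~ b) i (Not f).
Proof.
case=> g [st pre blocks]; have [h [st' preh def_h]] := prenex_not pre; exists h; split=> //.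
  exact: prenex_steps_trans (prenex_steps_not st) st'.
rewrite def_h nblocks_negb; case: blocks => [[-> head_g]|lt_i]; last by right.
by left; split=> //; case: (prefix_of g) head_g => //= c s ->.
Qed.

(** Negation dualizes every quantifier of a prenex form, and the complement of a separator separates
    in the opposite direction. *)
Lemma separable_complement b i (L1 L2 : language A) :
  separable (definable (alternation b i)) L1 L2 ->
  separable (definable (alternation (~~ b) i)) L2 L1.
Proof.
case=> K [[f [cl alt defK]] subK disK]; exists (fun w => models w (Not f)); split.
- by exists (Not f); split=> //; apply: alternation_not.
- by move=> w L2w; apply/negP=> /defK Kw; apply: (disK w).
- by move=> w [/negP nKw /subK/defK].
Qed.

End Complement.

(** * Deciding both separation problems *)

Lemma separable_Sigma2P (A : finType) (M1 M2 : nfa A) :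
  separable (Sigma 2) (recognized M1) (recognized M2) <->
  num_separable #|A| (nfa_code M1) (nfa_code M2).
Proof.
split=> [[K [sK subK disK]]|/num_separableP[J [satJ safeJ]]].
  have [n [m up_K]] := Sigma2_word_le sK; apply/num_separableP.
  exact: separable_saturated up_K subK disK.
exact: saturated_separable satJ safeJ.
Qed.

Lemma computable_num_separable_swap : computable (fun e =>
  num_separable (head 0 e) (head 0 (behead (behead e))) (head 0 (behead e))).
Proof.
(* The arguments are pushed from last to first: the indices [1], [3], [2], from the outermost call
   inwards, are the original [1], [2], [0] raised by the number of entries already pushed. *)
exact: (computable_cons (computable_cons (computable_cons computable_num_separable
  (computable_var 2)) (computable_var 3)) (computable_var 1)).
Qed.

Theorem corollary7p3 :
  algorithmically_decidable (fun (A : finType) (M1 M2 : nfa A) =>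
    separable (Sigma 2) (recognized M1) (recognized M2)) /\
  algorithmically_decidable (fun (A : finType) (M1 M2 : nfa A) =>
    separable (Pi 2) (recognized M1) (recognized M2)).
Proof.
split.
  exists (fun t => num_separable (head 0 (tval t)) (head 0 (behead (tval t)))
    (head 0 (behead (behead (tval t))))).
  split=> [|A M1 M2] /=; first exact: (computable_num_separable 3).
  have := separable_Sigma2P M1 M2; case: num_separable => sepP.
    by split=> // -[]; apply/sepP.
  by split=> // /sepP.
exists (fun t => num_separable (head 0 (tval t)) (head 0 (behead (behead (tval t))))
  (head 0 (behead (tval t)))).
split=> [|A M1 M2] /=; first exact: (computable_num_separable_swap 3).
have sepP : separable (Pi 2) (recognized M1) (recognized M2) <->
    num_separable #|A| (nfa_code M2) (nfa_code M1).
  rewrite -separable_Sigma2P; split; first exact: (@separable_complement A false).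
  exact: (@separable_complement A true).
case: num_separable sepP => sepP; first by split=> // -[]; apply/sepP.
by split=> // /sepP.
Qed.
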